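(* Let $\Sigma(\mathsf{o}_{in}, \mathsf{o}_{out}, \vec a)$ be a $\Delta_0$ formula which implicitly defines $\mathsf{o}_{out}$ as a function of $\mathsf{o}_{in}$. Then there is an $\mathrm{NRC}$ expression $E$ (in the variant $\mathrm{NRC}[\mathsf{get}]$, i.e. possibly using the $\mathsf{get}$ operator) with the single free variable $\mathsf{o}_{in}$ such that for all nested relations $\mathsf{o}_{in}, \mathsf{o}_{out}, \vec a$ of the appropriate types, if $\Sigma(\mathsf{o}_{in}, \mathsf{o}_{out}, \vec a)$ holds then $E(\mathsf{o}_{in}) = \mathsf{o}_{out}$.
   Context: Types are generated by $T, U ::= \mathfrak{U} \mid \mathsf{Unit} \mid T \times U \mid \mathsf{Set}(T)$. Here $\mathfrak{U}$ is an arbitrary set of atoms (''Ur-elements''), $\mathsf{Unit}$ has a single element $\langle\rangle$, $T\times U$ is the cartesian product, and $\mathsf{Set}(T)$ is the set of all (finite or infinite) subsets of $T$. A nested relation of type $T$ is an element of the interpretation of $T$. Terms are $t,u ::= x \mid \langle\rangle \mid \langle t,u\rangle \mid \pi_1(t) \mid \pi_2(t)$ (well-typed). $\Delta_0$ formulas are $\varphi,\psi ::= t =_{\mathfrak U} u \mid t \neq_{\mathfrak U} u \mid \top \mid \bot \mid \varphi\vee\psi \mid \varphi\wedge\psi \mid \forall x \in t\,\varphi \mid \exists x\in t\,\varphi$, where in the bounded quantifiers $t$ has type $\mathsf{Set}(T)$ and $x$ has type $T$; $\neg\varphi$ is defined by dualizing all connectives and atoms, and $\varphi\to\psi := \neg\varphi\vee\psi$.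 Formulas are evaluated under assignments of nested relations to their free variables. A $\Delta_0$ formula $\Sigma(\vec i, o, \vec a)$ implicitly defines $o$ as a function of $\vec i$ if for any two assignments $\sigma_1,\sigma_2$ of nested relations (finite or infinite) to all free variables that both satisfy $\Sigma$, $\sigma_1(\vec i)=\sigma_2(\vec i)$ implies $\sigma_1(o)=\sigma_2(o)$. $\mathrm{NRC}[\mathsf{get}]$ expressions are typed expressions with free variables built from: variables; $\langle\rangle$; pairing $\langle E_1,E_2\rangle$; projections $\pi_1(E),\pi_2(E)$; the empty set $\emptyset$ of any type $\mathsf{Set}(T)$; singleton $\{E\}$; union $E_1\cup E_2$ and difference $E_1\setminus E_2$ of expressions of the same set type; the big union $\bigcup\{E_1 \mid x \in E_2\}$ (with $E_2:\mathsf{Set}(T)$, $x$ a variable of type $T$ bound in $E_1:\mathsf{Set}(U)$), denoting the union over all $x\in E_2$ of the values of $E_1$; and $\mathsf{get}_T(E)$ for $E:\mathsf{Set}(T)$, returning the unique element of $E$ if $E$ is a singleton and a fixed default element of $T$ otherwise. $\mathrm{NRC}$ is the fragment without $\mathsf{get}$. Booleans are encoded as $\mathsf{Set}(\mathsf{Unit})$ with true $=\{\langle\rangle\}$, false $=\emptyset$. *)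

(* Defs.v *)
From Stdlib Require Import List Classical ClassicalEpsilon.
Import ListNotations.
Set Implicit Arguments.

Inductive ty : Type :=
| TUr : ty
| TUnit : ty
| TProd : ty -> ty -> ty
| TSet : ty -> ty.

Fixpoint interp (A : Type) (T : ty) : Type :=
  match T with
  | TUr => A
  | TUnit => unit
  | TProd T1 T2 => (interp A T1 * interp A T2)%type
  | TSet T1 => interp A T1 -> Prop
  end.

Inductive var : list ty -> ty -> Type :=
| VZ : forall G T, var (T :: G) T
| VS : forall G S T, var G T -> var (S :: G) T.

Fixpoint env (A : Type) (G : list ty) : Type :=
  match G with
  | nil => unit
  | T :: G' => (interp A T * env A G')%type
  end.

Fixpoint lookup {A : Type} {G : list ty} {T : ty} (v : var G T) : env A G -> interp A T :=
  match v in var G T return env A G -> interp A T with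
  | @VZ _ _ => fun rho => fst rho
  | @VS G' S' T' v' => fun rho => @lookup A G' T' v' (snd rho)
  end.

Inductive term (G : list ty) : ty -> Type :=
| tvar : forall T, var G T -> term G T
| tunit : term G TUnit
| tpair : forall T1 T2, term G T1 -> term G T2 -> term G (TProd T1 T2)
| tfst : forall T1 T2, term G (TProd T1 T2) -> term G T1
| tsnd : forall T1 T2, term G (TProd T1 T2) -> term G T2.

Fixpoint teval {A : Type} {G : list ty} {T : ty} (t : term G T) (rho : env A G)
  : interp A T :=
  match t with
  | tvar v => lookup v rho
  | tunit _ => tt
  | tpair t1 t2 => (teval t1 rho, teval t2 rho)
  | tfst t1 => fst (teval t1 rho)
  | tsnd t1 => snd (teval t1 rho)
  end.

Inductive fml (G : list ty) : Type :=
| feq : term G TUr -> term G TUr -> fml G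
| fneq : term G TUr -> term G TUr -> fml G
| ftop : fml G
| fbot : fml G
| for_ : fml G -> fml G -> fml G
| fand : fml G -> fml G -> fml G
| fall : forall T, term G (TSet T) -> fml (T :: G) -> fml G
| fex : forall T, term G (TSet T) -> fml (T :: G) -> fml G.

Fixpoint sat {A : Type} {G : list ty} (rho : env A G) (phi : fml G) : Prop :=
  match phi with
  | feq t u => teval t rho = teval u rho
  | fneq t u => teval t rho <> teval u rho
  | ftop _ => True
  | fbot _ => False
  | for_ p q => sat rho p \/ sat rho q
  | fand p q => sat rho p /\ sat rho q
  | fall t p => forall x, teval t rho x -> sat ((x, rho) : env A (_ :: G)) p
  | fex t p => exists x, teval t rho x /\ sat ((x, rho) : env A (_ :: G)) p
  end.

Inductive expr (G : list ty) : ty -> Type :=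
| evar : forall T, var G T -> expr G T
| eunit : expr G TUnit
| epair : forall T1 T2, expr G T1 -> expr G T2 -> expr G (TProd T1 T2)
| efst : forall T1 T2, expr G (TProd T1 T2) -> expr G T1
| esnd : forall T1 T2, expr G (TProd T1 T2) -> expr G T2
| eempty : forall T, expr G (TSet T)
| esing : forall T, expr G T -> expr G (TSet T)
| eunion : forall T, expr G (TSet T) -> expr G (TSet T) -> expr G (TSet T)
| ediff : forall T, expr G (TSet T) -> expr G (TSet T) -> expr G (TSet T)
| ebigunion : forall T U, expr (T :: G) (TSet U) -> expr G (TSet T) -> expr G (TSet U)
| eget : forall T, expr G (TSet T) -> expr G T.

Fixpoint dflt {A : Type} (u0 : A) (T : ty) : interp A T :=
  match T with
  | TUr => u0
  | TUnit => tt
  | TProd T1 T2 => (dflt u0 T1, dflt u0 T2)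
  | TSet _ => fun _ => False
  end.

Definition get_sem {A : Type} (u0 : A) {T : ty} (s : interp A T -> Prop) : interp A T :=
  match excluded_middle_informative (exists! x, s x) with
  | left H => proj1_sig (constructive_indefinite_description _ H)
  | right _ => dflt u0 T
  end.

Fixpoint eeval {A : Type} (u0 : A) {G : list ty} {T : ty} (e : expr G T) (rho : env A G)
  : interp A T :=
  match e in expr _ T return interp A T with
  | evar v => lookup v rho
  | eunit _ => tt
  | epair e1 e2 => (eeval u0 e1 rho, eeval u0 e2 rho)
  | efst e1 => fst (eeval u0 e1 rho)
  | esnd e1 => snd (eeval u0 e1 rho)
  | eempty _ _ => fun _ => False
  | esing e1 => fun x => x = eeval u0 e1 rho
  | eunion e1 e2 => fun x => eeval u0 e1 rho x \/ eeval u0 e2 rho x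
  | ediff e1 e2 => fun x => eeval u0 e1 rho x /\ ~ eeval u0 e2 rho x
  | ebigunion e1 e2 =>
      fun y => exists x, eeval u0 e2 rho x /\ eeval u0 e1 ((x, rho) : env A (_ :: G)) y
  | eget e1 => get_sem u0 (eeval u0 e1 rho)
  end.

(* Sigma(o_in, o_out, a) implicitly defines o_out as a function of o_in:
   for every set of atoms A and all assignments (finite or infinite). *)
Definition implicitly_defines (Tin Tout : ty) (As : list ty)
  (Sigma : fml (Tin :: Tout :: As)) : Prop :=
  forall (A : Type) (i : interp A Tin) (o1 o2 : interp A Tout) (a1 a2 : env A As),
    sat ((i, (o1, a1)) : env A (Tin :: Tout :: As)) Sigma ->
    sat ((i, (o2, a2)) : env A (Tin :: Tout :: As)) Sigma ->
    o1 = o2.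

(* Main.v *)
Require Import Defs.
From Stdlib Require Import List Arith Lia Classical ClassicalEpsilon ChoiceFacts
  FunctionalExtensionality PropExtensionality Eqdep_dec Program.Equality.
Import ListNotations.
Set Implicit Arguments.

(** A Henkin-style argument. Two copies of the formula that share only the input are put on the
    two sides of a tableau. Given a left-hand object [r], call a state of the tableau separable
    if there are NRC expressions [E], [th Lhs], [th Rhs] over the shared variables such that each
    side [j] implies [th j] unless [r] is in [E], while [th Lhs] and [th Rhs] exclude each other.
    Separability propagates backwards through the tableau rules, because members of shared sets
    are made shared and then eliminated by big unions over those sets. Hence an inseparable state
    saturates to a Hintikka set, whose collapse is a joint model in nested relations.

    If [r] is, in every joint model, reached from a right-hand object by projections and passing
    to elements, then some [E] collects [r]. For an atom, an inseparable state would have a model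
    in which [r] differs from all right-hand atoms. For a set one uses an expression [c]
    containing the elements of [r], given by induction on the type, and the additional rule that
    [r] differs from a right-hand set [w] because some shared [z] in [c] belongs to exactly one
    of them. Applied to the two copies of the output this collects the output, and Craig
    interpolation then selects it among the collected candidates. *)

Lemma pred_ext (X : Type) (P Q : X -> Prop) : (forall x, P x <-> Q x) -> P = Q.
Proof.
  intros H; apply functional_extensionality; intros x.
  apply propositional_extensionality; auto.
Qed.

(** * Derived formulas *)

Definition tvar0 {T G} : term (T :: G) T := tvar (VZ G T).
Definition tvar1 {S T G} : term (S :: T :: G) T := tvar (VS S (VZ G T)).
Definition tvar2 {R S T G} : term (R :: S :: T :: G) T := tvar (VS R (VS S (VZ G T))).

Fixpoint tweaken {S G T} (t : term G T) : term (S :: G) T :=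
  match t with
  | tvar x => tvar (VS S x)
  | tunit _ => tunit _
  | tpair a b => tpair (tweaken a) (tweaken b)
  | tfst a => tfst (tweaken a)
  | tsnd a => tsnd (tweaken a)
  end.

Lemma teval_tweaken A S G T (t : term G T) (rho : env A G) (x : interp A S) :
  teval (tweaken (S := S) t) ((x, rho) : env A (S :: G)) = teval t rho.
Proof. induction t; simpl; congruence. Qed.

Fixpoint feq_at {T : ty} {G} : term G T -> term G T -> fml G :=
  match T return term G T -> term G T -> fml G with
  | TUr => fun a b => feq a b
  | TUnit => fun _ _ => ftop _
  | TProd T1 T2 => fun a b =>
      fand (feq_at (tfst a) (tfst b)) (feq_at (tsnd a) (tsnd b))
  | TSet T1 => fun a b =>
      fand (fall a (fex (tweaken b) (feq_at (tweaken tvar0) tvar0)))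
           (fall b (fex (tweaken a) (feq_at (tweaken tvar0) tvar0)))
  end.

Lemma sat_feq_at A T G (a b : term G T) (rho : env A G) :
  sat rho (feq_at a b) <-> teval a rho = teval b rho.
Proof.
  revert G a b rho; induction T as [| |T1 IH1 T2 IH2|T IH]; intros G a b rho; simpl.
  - reflexivity.
  - destruct (teval a rho), (teval b rho); tauto.
  - rewrite IH1, IH2; simpl.
    destruct (teval a rho), (teval b rho); simpl; intuition congruence.
  - setoid_rewrite IH; simpl; split.
    + intros [Hab Hba]; apply pred_ext; intros x; split; intros Hx.
      * destruct (Hab x Hx) as (y & Hy & ->); now rewrite teval_tweaken in Hy.
      * destruct (Hba x Hx) as (y & Hy & ->); now rewrite teval_tweaken in Hy.
    + intros Hab; split; intros x Hx; exists x; rewrite teval_tweaken;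
        (split; [congruence | reflexivity]).
Qed.

Definition fmem {T G} (x : term G T) (s : term G (TSet T)) : fml G :=
  fex s (feq_at tvar0 (tweaken x)).

Lemma sat_fmem A T G (x : term G T) (s : term G (TSet T)) (rho : env A G) :
  sat rho (fmem x s) <-> teval s rho (teval x rho).
Proof.
  unfold fmem; simpl; setoid_rewrite sat_feq_at; setoid_rewrite teval_tweaken; simpl.
  split; [now intros (y & Hy & <-) | eauto].
Qed.

Fixpoint fneg {G} (p : fml G) : fml G :=
  match p with
  | feq a b => fneq a b
  | fneq a b => feq a b
  | ftop _ => fbot _
  | fbot _ => ftop _
  | for_ p q => fand (fneg p) (fneg q)
  | fand p q => for_ (fneg p) (fneg q)
  | fall t p => fex t (fneg p)
  | fex t p => fall t (fneg p)
  end.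

Lemma sat_fneg A G (p : fml G) (rho : env A G) : sat rho (fneg p) <-> ~ sat rho p.
Proof.
  induction p as [| | | |G p IHp q IHq|G p IHp q IHq|G T t p IHp|G T t p IHp]; simpl;
    try tauto.
  - rewrite IHp, IHq; tauto.
  - rewrite IHp, IHq; tauto.
  - setoid_rewrite IHp; split.
    + firstorder.
    + intros H; apply NNPP; intros Hno; apply H; intros x Hx.
      apply NNPP; intros Hp; eauto.
  - setoid_rewrite IHp; firstorder.
Qed.

(** * Derived expressions *)

Definition rename_under {G G' : list ty} (f : forall U, var G U -> var G' U) {V W : ty}
  (x : var (V :: G) W) : var (V :: G') W :=
  match x in var L W return
    match L with
    | nil => unit
    | V :: G0 => (forall U, var G0 U -> var G' U) -> var (V :: G') W
    end
  with
  | VZ _ _ => fun _ => VZ _ _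
  | VS _ x' => fun g => VS _ (g _ x')
  end f.

Fixpoint erename {G G' T} (f : forall U, var G U -> var G' U) (e : expr G T) : expr G' T :=
  match e in expr _ T return expr G' T with
  | evar x => evar (f _ x)
  | eunit _ => eunit _
  | epair a b => epair (erename f a) (erename f b)
  | efst a => efst (erename f a)
  | esnd a => esnd (erename f a)
  | eempty _ U => eempty _ U
  | esing a => esing (erename f a)
  | eunion a b => eunion (erename f a) (erename f b)
  | ediff a b => ediff (erename f a) (erename f b)
  | ebigunion a b => ebigunion (erename (fun _ => rename_under f) a) (erename f b)
  | eget a => eget (erename f a)
  end.

Definition renames {A G G'} (f : forall U, var G U -> var G' U) (rho : env A G) (rho' : env A G') :=
  forall U (x : var G U), lookup (f U x) rho' = lookup x rho.

Lemma renames_under A G G' (f : forall U, var G U -> var G' U) (rho : env A G) (rho' : env A G')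
  V (y : interp A V) :
  renames f rho rho' ->
  renames (fun U => rename_under f (W := U))
    ((y, rho) : env A (V :: G)) ((y, rho') : env A (V :: G')).
Proof. intros H W x; dependent destruction x; simpl; auto. Qed.

Lemma eeval_ebigunion A (u0 : A) G (rho : env A G) T U (b : expr (T :: G) (TSet U))
  (c : expr G (TSet T)) (y : interp A U) :
  eeval u0 (ebigunion b c) rho y <->
  exists x : interp A T, eeval u0 c rho x /\ eeval u0 b ((x, rho) : env A (T :: G)) y.
Proof. reflexivity. Qed.

Lemma eeval_erename A (u0 : A) G T (e : expr G T) :
  forall G' (f : forall U, var G U -> var G' U) (rho : env A G) (rho' : env A G'),
  renames f rho rho' -> eeval u0 (erename f e) rho' = eeval u0 e rho.
Proof.
  induction e as [| |? ? ? ? IH1 ? IH2|? ? ? ? IH|? ? ? ? IH| |? ? ? IH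
    |? ? ? IH1 ? IH2|? ? ? IH1 ? IH2|? T U e1 IH1 e2 IH2|? ? ? IH];
    intros G' f rho rho' H;
    try (simpl; rewrite ?(IH _ f rho rho' H), ?(IH1 _ f rho rho' H), ?(IH2 _ f rho rho' H);
         solve [auto]).
  apply pred_ext; intros y; simpl erename; rewrite !eeval_ebigunion, (IH2 _ f rho rho' H).
  split; intros (x & Hx & Hy); exists x; split; auto;
    rewrite (IH1 _ _ _ _ (renames_under x H)) in *; exact Hy.
Qed.

Definition eweaken {S G T} (e : expr G T) : expr (S :: G) T := erename (fun _ x => VS S x) e.

Lemma eeval_eweaken A (u0 : A) S G T (e : expr G T) (rho : env A G) (x : interp A S) :
  eeval u0 (eweaken (S := S) e) ((x, rho) : env A (S :: G)) = eeval u0 e rho.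
Proof. apply eeval_erename; intros U y; reflexivity. Qed.

Notation bexpr G := (expr G (TSet TUnit)).

Definition test A (u0 : A) G (b : bexpr G) (rho : env A G) : Prop := eeval u0 b rho tt.

Definition etrue {G} : bexpr G := esing (eunit G).
Definition efalse {G} : bexpr G := eempty G TUnit.
Definition enot {G} (a : bexpr G) : bexpr G := ediff etrue a.
Definition eor {G} (a b : bexpr G) : bexpr G := eunion a b.
Definition eand {G} (a b : bexpr G) : bexpr G := enot (eor (enot a) (enot b)).
Definition eexists {G T} (b : bexpr (T :: G)) (c : expr G (TSet T)) : bexpr G := ebigunion b c.
Definition eforall {G T} (b : bexpr (T :: G)) (c : expr G (TSet T)) : bexpr G :=
  enot (eexists (enot b) c).
Definition eeq {G T} (a b : expr G T) : bexpr G :=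
  enot (eexists etrue (ediff (esing a) (esing b))).
Definition efilter {G T} (b : bexpr (T :: G)) (c : expr G (TSet T)) : expr G (TSet T) :=
  ebigunion (ebigunion (esing (evar (VS _ (VZ _ _)))) b) c.
Definition eproduct {G T1 T2} (a : expr G (TSet T1)) (b : expr G (TSet T2))
  : expr G (TSet (TProd T1 T2)) :=
  ebigunion (ebigunion (esing (epair (evar (VS _ (VZ _ _))) (evar (VZ _ _)))) (eweaken b)) a.

Lemma test_etrue A (u0 : A) G (rho : env A G) : test u0 etrue rho.
Proof. reflexivity. Qed.

Lemma test_efalse A (u0 : A) G (rho : env A G) : ~ test u0 efalse rho.
Proof. intros []. Qed.

Lemma test_enot A (u0 : A) G (rho : env A G) (a : bexpr G) :
  test u0 (enot a) rho <-> ~ test u0 a rho.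
Proof. unfold test; simpl; tauto. Qed.

Lemma test_eor A (u0 : A) G (rho : env A G) (a b : bexpr G) :
  test u0 (eor a b) rho <-> test u0 a rho \/ test u0 b rho.
Proof. reflexivity. Qed.

Lemma test_eand A (u0 : A) G (rho : env A G) (a b : bexpr G) :
  test u0 (eand a b) rho <-> test u0 a rho /\ test u0 b rho.
Proof. unfold eand; rewrite test_enot, test_eor, !test_enot; tauto. Qed.

Lemma test_eexists A (u0 : A) G (rho : env A G) T (b : bexpr (T :: G)) (c : expr G (TSet T)) :
  test u0 (eexists b c) rho <->
  exists y : interp A T, eeval u0 c rho y /\ test u0 b ((y, rho) : env A (T :: G)).
Proof. apply eeval_ebigunion. Qed.

Lemma test_eforall A (u0 : A) G (rho : env A G) T (b : bexpr (T :: G)) (c : expr G (TSet T)) :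
  test u0 (eforall b c) rho <->
  forall y, eeval u0 c rho y -> test u0 b ((y, rho) : env A (T :: G)).
Proof.
  unfold eforall; rewrite test_enot, test_eexists; setoid_rewrite test_enot; split.
  - intros H y Hy; apply NNPP; eauto.
  - intros H (y & Hy & Hb); auto.
Qed.

Lemma test_eeq A (u0 : A) G (rho : env A G) T (a b : expr G T) :
  test u0 (eeq a b) rho <-> eeval u0 a rho = eeval u0 b rho.
Proof.
  unfold eeq; rewrite test_enot, test_eexists; split.
  - intros H; apply NNPP; intros Hab; apply H; exists (eeval u0 a rho); split.
    + now split.
    + apply test_etrue.
  - intros Hab (y & [-> Hb] & _); now apply Hb.
Qed.

Lemma eeval_efilter A (u0 : A) G (rho : env A G) T (b : bexpr (T :: G)) (c : expr G (TSet T)) y :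
  eeval u0 (efilter b c) rho y <-> eeval u0 c rho y /\ test u0 b ((y, rho) : env A (T :: G)).
Proof.
  unfold test; simpl; split.
  - intros (x & Hx & [] & Hb & ->); auto.
  - intros [Hc Hb]; exists y; split; auto; exists tt; auto.
Qed.

Lemma eeval_eproduct A (u0 : A) G (rho : env A G) T1 T2 (a : expr G (TSet T1))
  (b : expr G (TSet T2)) x y :
  eeval u0 a rho x -> eeval u0 b rho y -> eeval u0 (eproduct a b) rho (x, y).
Proof.
  simpl; intros Hx Hy; exists x; split; auto; exists y; split; auto.
  now rewrite eeval_eweaken.
Qed.

(** * Names and valuations *)

Inductive side := Lhs | Rhs.

Definition pick {X : Type} (j : side) (a b : X) (j' : side) : X :=
  match j, j' with Lhs, Lhs | Rhs, Rhs => a | _, _ => b end.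

Lemma pick_same (X : Type) j (a b : X) : pick j a b j = a.
Proof. now destruct j. Qed.

Lemma pick_other (X : Type) j j' (a b : X) : j' <> j -> pick j a b j' = b.
Proof. destruct j, j'; easy. Qed.

Lemma side_eq_dec (j j' : side) : {j = j'} + {j <> j'}.
Proof. decide equality. Qed.

Inductive owner := Shared | Private (j : side).
Record name := Name { owner_of : owner; index : nat }.

Lemma ty_eq_dec (S T : ty) : {S = T} + {S <> T}.
Proof. decide equality. Qed.

(* Since pairs are split into names of their components, a formula together with a [tuples] of
   names for its free variables needs neither substitution nor projections. *)
Fixpoint tuple (T : ty) : Type :=
  match T with
  | TUr => name
  | TUnit => unit
  | TProd T1 T2 => (tuple T1 * tuple T2)%type
  | TSet _ => name
  end.

Fixpoint tuples (G : list ty) : Type :=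
  match G with
  | nil => unit
  | T :: G' => (tuple T * tuples G')%type
  end.

(* Only the values at [TUr] and at set types are ever read. *)
Definition valuation (A : Type) := forall T, name -> interp A T.

Fixpoint tuple_val {A} (v : valuation A) (T : ty) : tuple T -> interp A T :=
  match T with
  | TUr => v TUr
  | TUnit => fun _ => tt
  | TProd T1 T2 => fun x => (tuple_val v T1 (fst x), tuple_val v T2 (snd x))
  | TSet T' => v (TSet T')
  end.

Fixpoint tuples_val {A} (v : valuation A) (G : list ty) : tuples G -> env A G :=
  match G with
  | nil => fun _ => tt
  | T :: G' => fun e => (tuple_val v T (fst e), tuples_val v G' (snd e))
  end.

Fixpoint lookup_tuple {G T} (x : var G T) : tuples G -> tuple T :=
  match x with
  | VZ _ _ => fun e => fst e
  | VS _ x' => fun e => lookup_tuple x' (snd e)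
  end.

Fixpoint term_tuple {G T} (t : term G T) (e : tuples G) : tuple T :=
  match t with
  | tvar x => lookup_tuple x e
  | tunit _ => tt
  | tpair t1 t2 => (term_tuple t1 e, term_tuple t2 e)
  | tfst t1 => fst (term_tuple t1 e)
  | tsnd t1 => snd (term_tuple t1 e)
  end.

Lemma lookup_tuples_val A (v : valuation A) G T (x : var G T) (e : tuples G) :
  lookup x (tuples_val v G e) = tuple_val v T (lookup_tuple x e).
Proof. induction x; simpl; auto. Qed.

Lemma teval_tuples_val A (v : valuation A) G T (t : term G T) (e : tuples G) :
  teval t (tuples_val v G e) = tuple_val v T (term_tuple t e).
Proof.
  induction t as [? x| |? ? ? IH1 ? IH2|? ? ? IH|? ? ? IH]; simpl.
  - apply lookup_tuples_val.
  - reflexivity.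
  - now rewrite IH1, IH2.
  - now rewrite IH.
  - now rewrite IH.
Qed.

Fixpoint tuple_all (P : ty -> name -> Prop) (T : ty) : tuple T -> Prop :=
  match T with
  | TUr => P TUr
  | TUnit => fun _ => True
  | TProd T1 T2 => fun x => tuple_all P T1 (fst x) /\ tuple_all P T2 (snd x)
  | TSet T' => P (TSet T')
  end.

Fixpoint tuples_all (P : ty -> name -> Prop) (G : list ty) : tuples G -> Prop :=
  match G with
  | nil => fun _ => True
  | T :: G' => fun e => tuple_all P T (fst e) /\ tuples_all P G' (snd e)
  end.

Lemma tuple_all_impl (P Q : ty -> name -> Prop) T (x : tuple T) :
  (forall B n, P B n -> Q B n) -> tuple_all P T x -> tuple_all Q T x.
Proof. intros H; induction T; simpl; intuition. Qed.

Lemma tuples_all_impl (P Q : ty -> name -> Prop) G (e : tuples G) :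
  (forall B n, P B n -> Q B n) -> tuples_all P G e -> tuples_all Q G e.
Proof. intros H; induction G; simpl; intuition eauto using tuple_all_impl. Qed.

Lemma tuple_all_and (P Q : ty -> name -> Prop) T (x : tuple T) :
  tuple_all P T x -> tuple_all Q T x -> tuple_all (fun B n => P B n /\ Q B n) T x.
Proof. induction T; simpl; intuition. Qed.

Lemma tuple_all_term P G T (t : term G T) (e : tuples G) :
  tuples_all P G e -> tuple_all P T (term_tuple t e).
Proof.
  intros H; induction t as [T x| | | |]; simpl in *; intuition.
  induction x; simpl in *; intuition.
Qed.

Definition below (k : nat) (_ : ty) (n : name) : Prop := index n < k.

Definition agree (k : nat) {A} (v v' : valuation A) : Prop :=
  forall T n, index n < k -> v' T n = v T n.

Lemma agree_trans k k' A (v1 v2 v3 : valuation A) :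
  agree k v1 v2 -> k <= k' -> agree k' v2 v3 -> agree k v1 v3.
Proof. intros H12 Hk H23 T n Hn; rewrite H23 by lia; auto. Qed.

Lemma tuple_val_agree k A (v v' : valuation A) T (x : tuple T) :
  agree k v v' -> tuple_all (below k) T x -> tuple_val v' T x = tuple_val v T x.
Proof.
  intros H; induction T as [| |T1 IH1 T2 IH2|T _]; simpl.
  - exact (H TUr x).
  - reflexivity.
  - intros [H1 H2]; now rewrite IH1, IH2.
  - exact (H (TSet T) x).
Qed.

Lemma tuples_val_agree k A (v v' : valuation A) G (e : tuples G) :
  agree k v v' -> tuples_all (below k) G e -> tuples_val v' G e = tuples_val v G e.
Proof.
  intros H; induction G as [|T G IH]; simpl; auto.
  intros [H1 H2]; now rewrite IH, (tuple_val_agree _ _ H H1).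
Qed.

Fixpoint size (T : ty) : nat :=
  match T with
  | TUr => 1
  | TUnit => 0
  | TProd T1 T2 => size T1 + size T2
  | TSet _ => 1
  end.

Fixpoint fresh (w : owner) (T : ty) (k : nat) : tuple T :=
  match T with
  | TUr => Name w k
  | TUnit => tt
  | TProd T1 T2 => (fresh w T1 k, fresh w T2 (k + size T1))
  | TSet _ => Name w k
  end.

Fixpoint sizes (G : list ty) : nat :=
  match G with nil => 0 | T :: G' => size T + sizes G' end.

Fixpoint freshes (w : owner) (G : list ty) (k : nat) : tuples G :=
  match G with
  | nil => tt
  | T :: G' => (fresh w T k, freshes w G' (k + size T))
  end.

Lemma tuple_all_fresh (P : ty -> name -> Prop) w T k :
  (forall B n, k <= n < k + size T -> P B (Name w n)) -> tuple_all P T (fresh w T k).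
Proof.
  revert k; induction T as [| |T1 IH1 T2 IH2|T _]; simpl; intros k H; auto.
  - apply H; lia.
  - split; [apply IH1 | apply IH2]; intros; apply H; lia.
  - apply H; lia.
Qed.

Lemma tuples_all_freshes (P : ty -> name -> Prop) w G k :
  (forall B n, k <= n < k + sizes G -> P B (Name w n)) -> tuples_all P G (freshes w G k).
Proof.
  revert k; induction G as [|T G IH]; simpl; intros k H; auto.
  split; [apply tuple_all_fresh | apply IH]; intros; apply H; lia.
Qed.

(* The owner is ignored: copies of a fresh tuple for different owners get the same value. *)
Definition assign {A} (v : valuation A) (k : nat) (T : ty) (y : interp A T) : valuation A :=
  fun T' n =>
    if Nat.eq_dec (index n) k then
      match ty_eq_dec T T' with
      | left e => eq_rect T (interp A) y T' e
      | right _ => v T' n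
      end
    else v T' n.

Lemma agree_assign A (v : valuation A) k T (y : interp A T) : agree k v (assign v k T y).
Proof. intros T' n Hn; unfold assign; destruct Nat.eq_dec; [lia | reflexivity]. Qed.

Lemma assign_same A (v : valuation A) k T (y : interp A T) w : assign v k T y T (Name w k) = y.
Proof.
  unfold assign; simpl; destruct Nat.eq_dec; [|easy].
  destruct (ty_eq_dec T T); [|easy].
  symmetry; apply eq_rect_eq_dec; exact ty_eq_dec.
Qed.

Lemma fresh_assignable A (v : valuation A) T k (y : interp A T) :
  exists v', agree k v v' /\ forall w, tuple_val v' T (fresh w T k) = y.
Proof.
  revert k v; induction T as [| |T1 IH1 T2 IH2|T _]; intros k v.
  - exists (assign v k TUr y); split; [apply agree_assign | apply assign_same].
  - exists v; split; [easy | now destruct y].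
  - destruct y as [y1 y2].
    destruct (IH1 y1 k v) as (v1 & Hv1 & E1), (IH2 y2 (k + size T1) v1) as (v2 & Hv2 & E2).
    exists v2; split; [exact (agree_trans Hv1 (Nat.le_add_r _ _) Hv2)|].
    intros w; simpl; f_equal; [|apply E2].
    rewrite <- (E1 w); apply (tuple_val_agree _ _ Hv2).
    apply tuple_all_fresh; unfold below; simpl; lia.
  - exists (assign v k (TSet T) y); split; [apply agree_assign | apply assign_same].
Qed.

Lemma freshes_assignable A (v : valuation A) G k (y : env A G) :
  exists v', agree k v v' /\ forall w, tuples_val v' G (freshes w G k) = y.
Proof.
  revert k v; induction G as [|T G IH]; intros k v.
  - exists v; split; [easy | now destruct y].
  - destruct y as [y1 y2].
    destruct (fresh_assignable v T k y1) as (v1 & Hv1 & E1).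
    destruct (IH y2 (k + size T) v1) as (v2 & Hv2 & E2).
    exists v2; split; [exact (agree_trans Hv1 (Nat.le_add_r _ _) Hv2)|].
    intros w; simpl; f_equal; [|apply E2].
    rewrite <- (E1 w); apply (tuple_val_agree _ _ Hv2).
    apply tuple_all_fresh; unfold below; simpl; lia.
Qed.

(** * States of the tableau *)

Inductive item :=
| Member (T : ty) (x : tuple T) (t : name)
| Holds (G : list ty) (p : fml G) (e : tuples G).

Definition item_sat {A} (v : valuation A) (it : item) : Prop :=
  match it with
  | Member T x t => v (TSet T) t (tuple_val v T x)
  | @Holds G p e => sat (tuples_val v G e) p
  end.

Definition item_all (P : ty -> name -> Prop) (it : item) : Prop :=
  match it with
  | Member T x t => tuple_all P T x /\ P (TSet T) t
  | @Holds G _ e => tuples_all P G e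
  end.

Lemma item_all_impl (P Q : ty -> name -> Prop) it :
  (forall B n, P B n -> Q B n) -> item_all P it -> item_all Q it.
Proof. intros H; destruct it; simpl; intuition eauto using tuple_all_impl, tuples_all_impl. Qed.

Lemma item_sat_agree k A (v v' : valuation A) it :
  agree k v v' -> item_all (below k) it -> item_sat v it -> item_sat v' it.
Proof.
  intros H; destruct it as [T x t|G p e]; simpl.
  - intros [Hx Ht]; now rewrite (H _ _ Ht), (tuple_val_agree _ _ H Hx).
  - intros He; now rewrite (tuples_val_agree _ _ H He).
Qed.

Lemma sat_in A (v : valuation A) l it : Forall (item_sat v) l -> In it l -> item_sat v it.
Proof. rewrite Forall_forall; auto. Qed.

Definition eq_item (T : ty) (x y : tuple T) : item :=
  Holds (feq_at tvar0 tvar1) ((x, (y, tt)) : tuples [T; T]).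
Definition neq_item (T : ty) (x y : tuple T) : item :=
  Holds (fneg (feq_at tvar0 tvar1)) ((x, (y, tt)) : tuples [T; T]).
Definition membership_item (b : bool) (T : ty) (x : tuple T) (s : name) : item :=
  Holds (if b then fmem tvar0 tvar1 else fneg (fmem tvar0 tvar1))
    ((x, (s, tt)) : tuples [T; TSet T]).
Definition subset_item (T : ty) (r s : name) : item :=
  Holds (fall tvar0 (fmem tvar0 tvar2)) ((r, (s, tt)) : tuples [TSet T; TSet T]).

Definition signed (b : bool) (P : Prop) : Prop := if b then P else ~ P.

Section ItemSemantics.
Variables (A : Type) (v : valuation A).

Lemma sat_eq_item T (x y : tuple T) :
  item_sat v (eq_item T x y) <-> tuple_val v T x = tuple_val v T y.
Proof. apply sat_feq_at. Qed.

Lemma sat_neq_item T (x y : tuple T) :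
  item_sat v (neq_item T x y) <-> tuple_val v T x <> tuple_val v T y.
Proof. unfold neq_item; simpl; now rewrite sat_fneg, sat_feq_at. Qed.

Lemma sat_membership_item b T (x : tuple T) s :
  item_sat v (membership_item b T x s) <-> signed b (v (TSet T) s (tuple_val v T x)).
Proof. unfold membership_item, item_sat; destruct b; rewrite ?sat_fneg, sat_fmem; reflexivity. Qed.

Lemma sat_subset_item T r s :
  item_sat v (subset_item T r s) <-> forall y : interp A T, v (TSet T) r y -> v (TSet T) s y.
Proof.
  unfold subset_item, item_sat; split.
  - intros H y Hy; specialize (H y Hy); now rewrite sat_fmem in H.
  - intros H y Hy; apply sat_fmem; exact (H y Hy).
Qed.
End ItemSemantics.

Record state := State {
  bound : nat;
  ctx : list ty;
  shared : tuples ctx;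
  items : side -> list item }.

Definition shared_env {A} (v : valuation A) (s : state) : env A (ctx s) :=
  tuples_val v (ctx s) (shared s).

Definition satisfies {A} (v : valuation A) (s : state) : Prop :=
  forall j, Forall (item_sat v) (items s j).

Definition denotable (s : state) (T : ty) (n : name) : Prop :=
  exists e : expr (ctx s) T, forall A (u0 : A) (v : valuation A),
    eeval u0 e (shared_env v s) = v T n.

Definition visible (s : state) (j : side) (T : ty) (n : name) : Prop :=
  index n < bound s /\
  match owner_of n with Shared => denotable s T n | Private j' => j' = j end.

Definition mirrored (I : side -> list item) : Prop :=
  forall j j' T x t, owner_of t = Shared -> In (Member T x t) (I j) -> In (Member T x t) (I j').

Record wf (s : state) : Prop := Wf {
  wf_visible : forall j, Forall (item_all (visible s j)) (items s j);
  wf_mirrored : mirrored (items s);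
  wf_shared : tuples_all (below (bound s)) (ctx s) (shared s) }.

Definition extends (s s' : state) : Prop :=
  bound s <= bound s' /\ (forall T n, denotable s T n -> denotable s' T n) /\
  forall j, incl (items s j) (items s' j).

Lemma extends_refl s : extends s s.
Proof. split; [|split]; auto using incl_refl. Qed.

Lemma extends_trans s1 s2 s3 : extends s1 s2 -> extends s2 s3 -> extends s1 s3.
Proof.
  intros (H1 & H2 & H3) (H1' & H2' & H3'); split; [lia | split; [auto|]].
  intros j; eapply incl_tran; eauto.
Qed.

Lemma visible_extends s s' j T n : extends s s' -> visible s j T n -> visible s' j T n.
Proof.
  intros (Hb & Hd & _) [Hn Ho]; split; [lia|].
  destruct (owner_of n); auto.
Qed.

Lemma tuple_visible_extends s s' j T (x : tuple T) :
  extends s s' -> tuple_all (visible s j) T x -> tuple_all (visible s' j) T x.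
Proof. intros H; apply tuple_all_impl; intros B n; now apply visible_extends. Qed.

Lemma item_visible_extends s s' j it :
  extends s s' -> item_all (visible s j) it -> item_all (visible s' j) it.
Proof. intros H; apply item_all_impl; intros B n; now apply visible_extends. Qed.

Lemma visible_shared s j j' T n : owner_of n = Shared -> visible s j T n -> visible s j' T n.
Proof. intros Ho; unfold visible; now rewrite Ho. Qed.

Lemma denotable_shared s j T n : owner_of n = Shared -> visible s j T n -> denotable s T n.
Proof. intros Ho [_ Hn]; now rewrite Ho in Hn. Qed.

Lemma visible_below s j T n : visible s j T n -> below (bound s) T n.
Proof. now intros []. Qed.

Lemma visible_val_agree s j A (v v' : valuation A) T (x : tuple T) :
  agree (bound s) v v' -> tuple_all (visible s j) T x -> tuple_val v' T x = tuple_val v T x.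
Proof.
  intros Hv Hx; apply (tuple_val_agree _ _ Hv).
  revert Hx; apply tuple_all_impl, visible_below.
Qed.

Lemma wf_item_visible s j it : wf s -> In it (items s j) -> item_all (visible s j) it.
Proof. intros Hw; exact (proj1 (Forall_forall _ _) (wf_visible Hw j) it). Qed.

Lemma items_agree s j A (v v' : valuation A) :
  wf s -> agree (bound s) v v' ->
  Forall (item_sat v) (items s j) -> Forall (item_sat v') (items s j).
Proof.
  intros Hw Hv Hs; apply Forall_forall; intros it Hi.
  apply (item_sat_agree _ Hv); [|exact (sat_in _ Hs Hi)].
  generalize (wf_item_visible j it Hw Hi); apply item_all_impl, visible_below.
Qed.

Lemma satisfies_agree s A (v v' : valuation A) :
  wf s -> agree (bound s) v v' -> satisfies v s -> satisfies v' s.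
Proof. intros Hw Hv Hs j; exact (items_agree _ Hw Hv (Hs j)). Qed.

Lemma shared_env_agree s A (v v' : valuation A) :
  wf s -> agree (bound s) v v' -> shared_env v' s = shared_env v s.
Proof. intros Hw Hv; apply (tuples_val_agree _ _ Hv), Hw. Qed.

Lemma tuple_all_denotable s T (x : tuple T) (e : expr (ctx s) T) :
  (forall A (u0 : A) (v : valuation A), eeval u0 e (shared_env v s) = tuple_val v T x) ->
  tuple_all (denotable s) T x.
Proof.
  induction T as [| |T1 IH1 T2 IH2|T _]; simpl; intros H.
  - now exists e.
  - exact I.
  - split; [apply (IH1 _ (efst e)) | apply (IH2 _ (esnd e))]; intros; simpl; now rewrite H.
  - now exists e.
Qed.

Lemma tuple_visible_shared s j T (x : tuple T) :
  tuple_all (denotable s) T x ->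
  tuple_all (fun _ n => index n < bound s /\ owner_of n = Shared) T x ->
  tuple_all (visible s j) T x.
Proof.
  intros Hd Hs; generalize (tuple_all_and _ _ _ _ Hd Hs); apply tuple_all_impl.
  intros B n (Hn & Hb & Ho); split; [exact Hb | now rewrite Ho].
Qed.

Definition extend (w : owner) (T : ty) (l : tuple T -> side -> list item) (s : state) : state :=
  let x := fresh w T (bound s) in
  {| bound := bound s + size T;
     ctx := match w with Shared => T :: ctx s | Private _ => ctx s end;
     shared :=
       match w return tuples match w with Shared => T :: ctx s | Private _ => ctx s end with
       | Shared => (x, shared s)
       | Private _ => shared s
       end;
     items := fun j => l x j ++ items s j |}.

(* [TUnit] has no names, so only items are added. *)
Definition add (l : side -> list item) (s : state) : state :=
  extend (Private Lhs) TUnit (fun _ => l) s.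

Section Extension.
Variables (w : owner) (T : ty) (l : tuple T -> side -> list item) (s : state).
Let s' := extend w T l s.
Let x := fresh w T (bound s).

Lemma extends_extend : extends s s'.
Proof.
  split; [simpl; lia | split].
  - intros B n [e He]; unfold denotable; subst s'; destruct w; simpl.
    + exists (eweaken e); intros A u0 v; rewrite <- (He A u0 v); apply eeval_eweaken.
    + now exists e.
  - intros j; apply incl_appr, incl_refl.
Qed.

Lemma visible_fresh j :
  match w with Shared => True | Private j' => j' = j end -> tuple_all (visible s' j) T x.
Proof.
  intros Hj.
  assert (Hx : tuple_all (fun _ n => index n < bound s' /\ owner_of n = w) T x).
  { apply tuple_all_fresh; simpl; intros; split; [lia | reflexivity]. }
  subst s' x; destruct w as [|j'].
  - apply tuple_visible_shared; [|exact Hx].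
    apply tuple_all_denotable with (e := evar (VZ _ _)); reflexivity.
  - revert Hx; apply tuple_all_impl; intros B n [Hb Ho]; unfold visible; now rewrite Ho.
Qed.

Lemma wf_extend :
  wf s -> (forall j, Forall (item_all (visible s' j)) (l x j)) -> mirrored (l x) -> wf s'.
Proof.
  intros [Hvis Hmir Hsh] Hl Hm; split.
  - intros j; apply Forall_app; split; [apply Hl|].
    eapply Forall_impl; [|apply Hvis]; intros it; apply item_visible_extends, extends_extend.
  - intros j j' B y t Ht Hi; apply in_app_or in Hi as [Hi|Hi]; apply in_or_app; eauto.
  - assert (Hsh' : tuples_all (below (bound s')) (ctx s) (shared s)).
    { revert Hsh; apply tuples_all_impl; unfold below; simpl; lia. }
    subst s'; destruct w; simpl; auto; split; auto.
    apply tuple_all_fresh; unfold below; simpl; lia.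
Qed.

Lemma satisfies_extend A (v : valuation A) :
  satisfies v s' <-> satisfies v s /\ forall j, Forall (item_sat v) (l x j).
Proof.
  split.
  - intros H; split; intros j; now apply (proj1 (Forall_app _ _ _) (H j)).
  - intros [Hs Hl] j; apply Forall_app; auto.
Qed.
End Extension.

Lemma shared_env_extend T l s A (v v' : valuation A) (y : interp A T) :
  wf s -> agree (bound s) v v' -> tuple_val v' T (fresh Shared T (bound s)) = y ->
  shared_env v' (extend Shared T l s) = (y, shared_env v s).
Proof.
  intros Hs Hv <-; rewrite <- (shared_env_agree Hs Hv); reflexivity.
Qed.

Definition local (it : item) : Prop :=
  match it with Member _ _ t => owner_of t <> Shared | Holds _ _ => True end.

Lemma mirrored_local (I : side -> list item) : (forall j, Forall local (I j)) -> mirrored I.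
Proof.
  intros H j j' T x t Ht Hi.
  destruct (proj1 (Forall_forall _ _) (H j) _ Hi Ht).
Qed.

Lemma mirrored_cons it (I : side -> list item) : mirrored I -> mirrored (fun j => it :: I j).
Proof. intros H j j' T x t Ht [->|Hi]; [now left | right; eauto]. Qed.

(** * Separation *)

Section Separation.
Variables (U : ty) (target : option (tuple U)).

Definition hits {A} (v : valuation A) (E : interp A U -> Prop) : Prop :=
  match target with Some r => E (tuple_val v U r) | None => False end.

Definition in_scope (s : state) : Prop :=
  match target with Some r => tuple_all (visible s Lhs) U r | None => True end.

(* With the target [None], [th Lhs] is a Craig interpolant. *)
Definition separates (s : state) (E : expr (ctx s) (TSet U)) (th : side -> bexpr (ctx s)) :=
  (forall A (u0 : A) (v : valuation A) j, Forall (item_sat v) (items s j) ->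
     ~ hits v (eeval u0 E (shared_env v s)) -> test u0 (th j) (shared_env v s)) /\
  (forall A (u0 : A) (rho : env A (ctx s)), ~ forall j, test u0 (th j) rho).

Definition separable (s : state) : Prop := exists E th, separates s E th.

Lemma hits_mono A (v : valuation A) (E E' : interp A U -> Prop) :
  (forall y, E y -> E' y) -> hits v E -> hits v E'.
Proof. unfold hits; destruct target; auto. Qed.

Lemma hits_agree s A (v v' : valuation A) (E : interp A U -> Prop) :
  in_scope s -> agree (bound s) v v' -> hits v' E -> hits v E.
Proof.
  unfold hits, in_scope; destruct target as [r|]; auto.
  intros Hr Hv; now rewrite (visible_val_agree _ _ _ _ Hv Hr).
Qed.

Lemma in_scope_extends s s' : extends s s' -> in_scope s -> in_scope s'.
Proof.
  intros H; unfold in_scope; destruct target; auto.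
  exact (tuple_visible_extends _ _ _ H).
Qed.

Lemma separable_unsat s j :
  (forall A (v : valuation A), ~ Forall (item_sat v) (items s j)) -> separable s.
Proof.
  intros H; exists (eempty _ _), (pick j efalse etrue); split.
  - intros A u0 v j' Hs _.
    destruct (side_eq_dec j' j) as [->|Hj]; [destruct (H A v Hs)|].
    rewrite pick_other by assumption; apply test_etrue.
  - intros A u0 rho Hth; specialize (Hth j); rewrite pick_same in Hth.
    exact (test_efalse Hth).
Qed.

Lemma separable_clash s j j' n m :
  j' <> j -> denotable s TUr n -> denotable s TUr m ->
  In (eq_item TUr n m) (items s j) -> In (neq_item TUr n m) (items s j') -> separable s.
Proof.
  intros Hj [a Ha] [b Hb] Heq Hneq.
  exists (eempty _ _), (pick j (eeq a b) (enot (eeq a b))); split.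
  - intros A u0 v i Hs _.
    destruct (side_eq_dec i j) as [->|Hi].
    + rewrite pick_same, test_eeq, Ha, Hb; exact (sat_in _ Hs Heq).
    + rewrite pick_other, test_enot, test_eeq, Ha, Hb by assumption.
      replace i with j' in * by (destruct i, j, j'; congruence); exact (sat_in _ Hs Hneq).
  - intros A u0 rho Hth; pose proof (Hth j) as H1; pose proof (Hth j') as H2.
    rewrite pick_same in H1; rewrite pick_other, test_enot in H2 by assumption; auto.
Qed.

Lemma separable_branch s j l1 l2 :
  (forall A (v : valuation A), Forall (item_sat v) (items s j) ->
     Forall (item_sat v) l1 \/ Forall (item_sat v) l2) ->
  separable (add (pick j l1 []) s) -> separable (add (pick j l2 []) s) -> separable s.
Proof.
  intros H (E1 & th1 & Hth1 & Hexcl1) (E2 & th2 & Hth2 & Hexcl2); simpl in E1, th1, E2, th2.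
  exists (eunion E1 E2), (fun i => pick j eor eand i (th1 i) (th2 i)); split.
  - intros A u0 v i Hs Hn.
    assert (Hn1 : ~ hits v (eeval u0 E1 (shared_env v s))).
    { intros Hh; apply Hn; revert Hh; apply hits_mono; simpl; auto. }
    assert (Hn2 : ~ hits v (eeval u0 E2 (shared_env v s))).
    { intros Hh; apply Hn; revert Hh; apply hits_mono; simpl; auto. }
    specialize (fun Hi => Hth1 A u0 v i Hi Hn1); specialize (fun Hi => Hth2 A u0 v i Hi Hn2).
    simpl in Hth1, Hth2; rewrite Forall_app in Hth1, Hth2.
    destruct (side_eq_dec i j) as [->|Hi].
    + rewrite !pick_same in *; rewrite test_eor; destruct (H A v Hs); auto.
    + rewrite !pick_other in * by assumption; rewrite test_eand; auto.
  - intros A u0 rho Hth; pose proof (Hth j) as Hj; rewrite pick_same, test_eor in Hj.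
    assert (Hother : forall i, i <> j -> test u0 (th1 i) rho /\ test u0 (th2 i) rho).
    { intros i Hi; specialize (Hth i); now rewrite pick_other, test_eand in Hth. }
    destruct Hj as [Hj|Hj]; [apply (Hexcl1 A u0 rho) | apply (Hexcl2 A u0 rho)]; intros i;
      (destruct (side_eq_dec i j) as [->|Hi]; [exact Hj | now apply Hother]).
Qed.

Lemma separable_private s j T (l : tuple T -> list item) :
  wf s -> in_scope s ->
  (forall A (v : valuation A), Forall (item_sat v) (items s j) ->
     exists y, forall v', agree (bound s) v v' ->
       tuple_val v' T (fresh (Private j) T (bound s)) = y ->
       Forall (item_sat v') (l (fresh (Private j) T (bound s)))) ->
  separable (extend (Private j) T (fun x => pick j (l x) []) s) -> separable s.
Proof.
  intros Hw Hsc H (E & th & Hth & Hexcl); exists E, th; split; [|exact Hexcl].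
  intros A u0 v i Hs Hn.
  assert (Hv' : exists v', agree (bound s) v v' /\
    Forall (item_sat v') (pick j (l (fresh (Private j) T (bound s))) [] i)).
  { destruct (side_eq_dec i j) as [->|Hi].
    - destruct (H A v Hs) as [y Hy], (fresh_assignable v T (bound s) y) as (v' & Hv & Hval).
      exists v'; rewrite pick_same; auto.
    - exists v; rewrite pick_other by assumption; split; [easy | constructor]. }
  destruct Hv' as (v' & Hv & Hl).
  rewrite <- (shared_env_agree Hw Hv); apply (Hth A u0 v' i).
  - apply Forall_app; split; eauto using items_agree.
  - intros Hh; apply Hn; rewrite <- (shared_env_agree Hw Hv).
    exact (hits_agree _ _ Hsc Hv Hh).
Qed.

Definition extend_member T (t : name) (l : tuple T -> side -> list item) : state -> state :=
  extend Shared T (fun x j => Member T x t :: l x j).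

Lemma separates_member s T t l E th :
  separates (extend_member T t l s) E th -> wf s -> in_scope s -> index t < bound s ->
  forall A (u0 : A) (v : valuation A) j (y : interp A T),
  v (TSet T) t y -> Forall (item_sat v) (items s j) ->
  ~ hits v (eeval u0 E ((y, shared_env v s) : env A (T :: ctx s))) ->
  (forall v', agree (bound s) v v' -> tuple_val v' T (fresh Shared T (bound s)) = y ->
     Forall (item_sat v') (l (fresh Shared T (bound s)) j)) ->
  test u0 (th j) ((y, shared_env v s) : env A (T :: ctx s)).
Proof.
  intros [Hth _] Hw Hsc Ht A u0 v j y Hy Hs Hn Hl.
  destruct (fresh_assignable v T (bound s) y) as (v' & Hv & Hval); specialize (Hval Shared).
  specialize (Hth A u0 v' j); unfold extend_member in Hth.
  rewrite (shared_env_extend _ _ Hw Hv Hval) in Hth; apply Hth.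
  - simpl; constructor; [|apply Forall_app; split; eauto using items_agree].
    simpl; rewrite Hval, (Hv _ _ Ht); exact Hy.
  - intros Hh; exact (Hn (hits_agree _ _ Hsc Hv Hh)).
Qed.

Lemma separable_member s j T t (l : tuple T -> list item) :
  wf s -> in_scope s -> denotable s (TSet T) t -> index t < bound s ->
  (forall A (v : valuation A), Forall (item_sat v) (items s j) ->
     exists y : interp A T, v (TSet T) t y /\ forall v', agree (bound s) v v' ->
       tuple_val v' T (fresh Shared T (bound s)) = y ->
       Forall (item_sat v') (l (fresh Shared T (bound s)))) ->
  separable (extend_member T t (fun x => pick j (l x) []) s) -> separable s.
Proof.
  intros Hw Hsc [et Het] Ht H (E & th & Hsep); pose proof Hsep as [_ Hexcl]; simpl in E, th.
  exists (ebigunion E et), (fun i => pick j eexists eforall i (th i) et); split.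
  - intros A u0 v i Hs Hn.
    assert (Hn' : forall y : interp A T, v (TSet T) t y ->
      ~ hits v (eeval u0 E ((y, shared_env v s) : env A (T :: ctx s)))).
    { intros y Hy Hh; apply Hn; revert Hh; apply hits_mono; intros z Hz.
      apply eeval_ebigunion; rewrite Het; eauto. }
    destruct (side_eq_dec i j) as [->|Hi].
    + rewrite pick_same, test_eexists, Het.
      destruct (H A v Hs) as (y & Hy & Hl); exists y; split; [exact Hy|].
      apply (separates_member Hsep); auto; rewrite pick_same; exact Hl.
    + rewrite pick_other, test_eforall, Het by assumption; intros y Hy.
      apply (separates_member Hsep); auto.
      intros v' _ _; rewrite pick_other by assumption; constructor.
  - intros A u0 rho Hth; pose proof (Hth j) as Hj; rewrite pick_same, test_eexists in Hj.
    destruct Hj as (y & Hy & Hj); apply (Hexcl A u0 (y, rho)); intros i.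
    destruct (side_eq_dec i j) as [->|Hi]; [exact Hj|].
    specialize (Hth i); rewrite pick_other, test_eforall in Hth by assumption; auto.
Qed.
End Separation.

Arguments hits {U} target {A} v E.
Arguments in_scope {U} target s.
Arguments separable {U} target s.

Lemma separable_shared_atom s (r c : name) :
  In (eq_item TUr r c) (items s Lhs) -> denotable s TUr c -> separable (U := TUr) (Some r) s.
Proof.
  intros H [a Ha]; exists (esing a), (pick Lhs efalse etrue); split.
  - intros A u0 v [] Hs Hn; [|apply test_etrue].
    destruct Hn; simpl; rewrite Ha; exact (sat_in _ Hs H).
  - intros A u0 rho Hth; exact (test_efalse (Hth Lhs)).
Qed.

Definition distinguish (b : bool) (T : ty) (r w c : name) : state -> state :=
  extend_member T c (fun z =>
    pick Lhs [membership_item b T z r] [membership_item (negb b) T z w]).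

Definition confined (T : ty) (r c : name) (s : state) : Prop :=
  In (subset_item T r c) (items s Lhs) /\ owner_of c = Shared /\ visible s Lhs (TSet T) c.

Lemma separates_distinguish b T s (r w c : name) E th :
  separates (U := TSet T) (Some r) (distinguish b T r w c s) E th ->
  wf s -> visible s Lhs (TSet T) r -> index w < bound s -> index c < bound s ->
  forall A (u0 : A) (v : valuation A) j (y : interp A T),
  v (TSet T) c y -> Forall (item_sat v) (items s j) ->
  ~ eeval u0 E ((y, shared_env v s) : env A (T :: ctx s)) (v (TSet T) r) ->
  match j with Lhs => signed b (v (TSet T) r y) | Rhs => signed (negb b) (v (TSet T) w y) end ->
  test u0 (th j) ((y, shared_env v s) : env A (T :: ctx s)).
Proof.
  intros Hsep Hw Hr Hwb Hc A u0 v j y Hy Hs Hn Hj.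
  apply (separates_member Hsep); auto.
  intros v' Hv Hval; destruct j; (constructor; [|constructor]); apply sat_membership_item;
    rewrite Hval, Hv; auto; apply Hr.
Qed.

(* [E] collects [{z in c | th1 Lhs z}]: if [r] escapes it and both recursive collections, then
   some [z] satisfies both left interpolants, which the right side refutes by looking at [w]. *)
Lemma separable_distinguish T s (r c w : name) :
  wf s -> visible s Lhs (TSet T) r -> index w < bound s -> confined T r c s ->
  (forall b, separable (U := TSet T) (Some r) (distinguish b T r w c s)) ->
  separable (U := TSet T) (Some r) s.
Proof.
  intros Hw Hr Hwb (Hsub & Hoc & Hcv) H.
  pose proof (proj1 Hcv) as Hc; destruct (denotable_shared Hoc Hcv) as [ec Hec].
  destruct (H true) as (E1 & th1 & Hsep1), (H false) as (E2 & th2 & Hsep2).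
  simpl in E1, th1, E2, th2.
  exists (eunion (esing (efilter (th1 Lhs) ec)) (ebigunion (eunion E1 E2) ec)),
    (pick Lhs (eexists (eand (th1 Lhs) (th2 Lhs)) ec) (eforall (eor (th1 Rhs) (th2 Rhs)) ec)).
  split.
  - intros A u0 v j Hs Hn.
    assert (Hn' : forall y : interp A T, v (TSet T) c y ->
      ~ eeval u0 (eunion E1 E2) ((y, shared_env v s) : env A (T :: ctx s)) (v (TSet T) r)).
    { intros y Hy Hh; apply Hn; right; apply eeval_ebigunion; rewrite Hec; eauto. }
    pose proof (fun y Hy => separates_distinguish Hsep1 Hw Hr Hwb Hc u0 j y Hy Hs
      (fun Hh => Hn' y Hy (or_introl Hh))) as Hth1.
    pose proof (fun y Hy => separates_distinguish Hsep2 Hw Hr Hwb Hc u0 j y Hy Hs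
      (fun Hh => Hn' y Hy (or_intror Hh))) as Hth2.
    destruct j; simpl pick; simpl in Hth1, Hth2.
    + pose proof (sat_in _ Hs Hsub) as Hrc; rewrite sat_subset_item in Hrc.
      apply test_eexists; apply NNPP; intros Hno; apply Hn; left.
      change (v (TSet T) r = eeval u0 (efilter (th1 Lhs) ec) (shared_env v s)).
      apply pred_ext; intros y; rewrite eeval_efilter, Hec; split; [auto|].
      intros [Hy Hty]; apply NNPP; intros Hry; apply Hno.
      exists y; rewrite Hec, test_eand; auto.
    + apply test_eforall; intros y Hy; rewrite Hec in Hy; apply test_eor.
      destruct (classic (v (TSet T) w y)); auto.
  - intros A u0 rho Hth; pose proof (Hth Lhs) as HL; pose proof (Hth Rhs) as HR.
    simpl in HL, HR; rewrite test_eexists in HL; rewrite test_eforall in HR.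
    destruct HL as (y & Hy & HL); apply test_eand in HL as [HL1 HL2].
    apply HR, test_eor in Hy as [HR'|HR'];
      [apply (proj2 Hsep1 A u0 (y, rho)) | apply (proj2 Hsep2 A u0 (y, rho))]; intros []; auto.
Qed.

(** * Saturation *)

Section FairChain.
Variables (X : Type) (R : X -> X -> Prop) (ok : X -> Prop) (task : X -> (X -> Prop) -> Prop).
Hypothesis R_refl : forall x, R x x.
Hypothesis R_trans : forall x y z, R x y -> R y z -> R x z.
Hypothesis task_finite : forall x, exists L, forall Q, task x Q -> In Q L.
Hypothesis task_stable : forall x Q, task x Q -> forall y z, R y z -> Q y -> Q z.
Hypothesis task_attained : forall x Q, task x Q ->
  forall y, R x y -> ok y -> exists z, R y z /\ ok z /\ Q z.

Lemma fair_step x : ok x -> exists y, ok y /\ R x y /\ forall Q, task x Q -> Q y.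
Proof.
  intros Hx; destruct (task_finite x) as [L HL].
  enough (H : exists y, ok y /\ R x y /\ forall Q, In Q L -> task x Q -> Q y).
  { destruct H as (y & Hy & Hxy & H); exists y; split; [|split]; auto.
    intros Q HQ; exact (H Q (HL Q HQ) HQ). }
  clear HL; induction L as [|Q L (y & Hy & Hxy & HL)].
  - exists x; split; [auto | split; [auto | intros Q []]].
  - destruct (classic (task x Q)) as [HQ|HQ].
    + destruct (task_attained HQ Hxy Hy) as (z & Hyz & Hz & HQz).
      exists z; split; [auto | split; [eauto|]].
      intros Q' [<-|Hi] HQ'; [exact HQz | exact (task_stable HQ' Hyz (HL _ Hi HQ'))].
    + exists y; split; [auto | split; [auto|]].
      intros Q' [<-|Hi] HQ'; [contradiction | exact (HL _ Hi HQ')].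
Qed.

Lemma fair_chain x : ok x ->
  exists c : nat -> X, c 0 = x /\ (forall n, ok (c n)) /\ (forall n m, n <= m -> R (c n) (c m)) /\
    forall n Q, task (c n) Q -> Q (c (S n)).
Proof.
  intros Hx.
  destruct (functional_choice_imp_functional_dependent_choice choice
    (fun x y => ok x -> ok y /\ R x y /\ forall Q, task x Q -> Q y)) with (x0 := x)
    as (c & Hc0 & Hc).
  { intros y; destruct (classic (ok y)) as [Hy|Hy]; [|exists y; contradiction].
    destruct (fair_step Hy) as [z Hz]; now exists z. }
  assert (Hok : forall n, ok (c n)).
  { induction n as [|n IH]; [now rewrite Hc0 | exact (proj1 (Hc n IH))]. }
  exists c; split; [exact Hc0 | split; [exact Hok | split]].
  - induction 1 as [|m _ IH]; [apply R_refl|].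
    exact (R_trans IH (proj1 (proj2 (Hc m (Hok m))))).
  - intros n; exact (proj2 (proj2 (Hc n (Hok n)))).
Qed.
End FairChain.

Definition decomposed (j : side) (it : item) (s : state) : Prop :=
  match it with
  | Member _ _ _ => True
  | @Holds G p e =>
      match p with
      | for_ a b => In (Holds a e) (items s j) \/ In (Holds b e) (items s j)
      | fand a b => In (Holds a e) (items s j) /\ In (Holds b e) (items s j)
      | @fex _ T t a => exists x, In (Member T x (term_tuple t e)) (items s j) /\
          In (Holds a ((x, e) : tuples (T :: G))) (items s j)
      | _ => True
      end
  end.

Inductive instance : item -> item -> item -> Prop :=
| Instance G T (t : term G (TSet T)) (p : fml (T :: G)) (e : tuples G) (x : tuple T) :
    instance (Holds (fall t p) e) (Member T x (term_tuple t e))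
      (Holds p ((x, e) : tuples (T :: G))).

Lemma instance_functional it m i i' : instance it m i -> instance it m i' -> i = i'.
Proof. intros [G T t p e x] H; now dependent destruction H. Qed.

Lemma item_all_instance P it m i :
  instance it m i -> item_all P it -> item_all P m -> item_all P i.
Proof. intros []; simpl; intuition. Qed.

Lemma item_sat_instance A (v : valuation A) it m i :
  instance it m i -> item_sat v it -> item_sat v m -> item_sat v i.
Proof. intros [G T t p e x] Hit Hm; apply Hit; rewrite teval_tuples_val; exact Hm. Qed.

Definition instantiated (j : side) (it m : item) (s : state) : Prop :=
  forall i, instance it m i -> In i (items s j).

Definition decided (j : side) (n m : name) (s : state) : Prop :=
  In (eq_item TUr n m) (items s j) \/ In (neq_item TUr n m) (items s j).

Definition stable (Q : state -> Prop) : Prop := forall s s', extends s s' -> Q s -> Q s'.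

Lemma decomposed_stable j it : stable (decomposed j it).
Proof.
  intros s s' (_ & _ & H); specialize (H j); destruct it as [|G p e]; simpl; auto.
  destruct p; simpl; auto; firstorder.
Qed.

Lemma instantiated_stable j it m : stable (instantiated j it m).
Proof. intros s s' (_ & _ & H) Hs i Hi; apply H; auto. Qed.

Lemma decided_stable j n m : stable (decided j n m).
Proof. intros s s' (_ & _ & H); unfold decided; specialize (H j); intuition. Qed.

Lemma Forall_pick (P : side -> item -> Prop) j l :
  Forall (P j) l -> forall j', Forall (P j') (pick j l [] j').
Proof. intros H j'; destruct j, j'; auto. Qed.

Section Attainment.
Variables (U : ty) (target : option (tuple U)).

Definition consistent (s : state) : Prop :=
  wf s /\ in_scope target s /\ ~ separable target s.

Definition attains (s : state) (Q : state -> Prop) : Prop :=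
  exists s', extends s s' /\ consistent s' /\ Q s'.

Lemma attains_now s (Q : state -> Prop) : consistent s -> Q s -> attains s Q.
Proof. exists s; auto using extends_refl. Qed.

Lemma attains_impl s (Q Q' : state -> Prop) :
  (forall s', Q s' -> Q' s') -> attains s Q -> attains s Q'.
Proof. intros H (s' & Hs' & Hc & HQ); exists s'; auto. Qed.

Lemma attains_extend w T l s (Q : state -> Prop) :
  consistent s -> (separable target (extend w T l s) -> separable target s) ->
  (forall j, Forall (item_all (visible (extend w T l s) j)) (l (fresh w T (bound s)) j)) ->
  mirrored (l (fresh w T (bound s))) -> Q (extend w T l s) -> attains s Q.
Proof.
  intros (Hw & Hsc & Hns) Hsep Hl Hm HQ.
  exists (extend w T l s); split; [apply extends_extend | split; [|exact HQ]].
  split; [now apply wf_extend | split; [|auto]].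
  revert Hsc; apply in_scope_extends, extends_extend.
Qed.

Lemma attains_either j l1 l2 s :
  consistent s -> Forall (item_all (visible s j)) (l1 ++ l2) -> Forall local (l1 ++ l2) ->
  (forall A (v : valuation A), Forall (item_sat v) (items s j) ->
     Forall (item_sat v) l1 \/ Forall (item_sat v) l2) ->
  attains s (fun s' => incl l1 (items s' j) \/ incl l2 (items s' j)).
Proof.
  intros Hc Hvis Hloc Hsat.
  apply Forall_app in Hvis as [Hvis1 Hvis2]; apply Forall_app in Hloc as [Hloc1 Hloc2].
  assert (Hadd : forall l, Forall (item_all (visible s j)) l -> Forall local l ->
    ~ separable target (add (pick j l []) s) -> attains s (fun s' => incl l (items s' j))).
  { intros l Hvis Hloc Hns; apply attains_extend with (w := Private Lhs) (T := TUnit)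
      (l := fun _ => pick j l []); auto; [contradiction| | |].
    - apply (Forall_pick (fun i => item_all (visible (add (pick j l []) s) i))).
      revert Hvis; apply Forall_impl; intros it; apply item_visible_extends, extends_extend.
    - apply mirrored_local, (Forall_pick (fun _ => local)), Hloc.
    - simpl; rewrite pick_same; apply incl_appl, incl_refl. }
  destruct (classic (separable target (add (pick j l1 []) s))) as [Hs1|Hs1];
    [destruct (classic (separable target (add (pick j l2 []) s))) as [Hs2|Hs2]|].
  - destruct Hc as (_ & _ & Hns), Hns; exact (separable_branch Hsat Hs1 Hs2).
  - apply attains_impl with (2 := Hadd l2 Hvis2 Hloc2 Hs2); auto.
  - apply attains_impl with (2 := Hadd l1 Hvis1 Hloc1 Hs1); auto.
Qed.

Lemma attains_all j l s :
  consistent s -> Forall (item_all (visible s j)) l -> Forall local l ->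
  (forall A (v : valuation A), Forall (item_sat v) (items s j) -> Forall (item_sat v) l) ->
  attains s (fun s' => incl l (items s' j)).
Proof.
  intros Hc Hvis Hloc Hsat.
  apply attains_impl with (Q := fun s' => incl l (items s' j) \/ incl l (items s' j)); [tauto|].
  apply attains_either; auto; apply Forall_app; auto.
Qed.

Section Witness.
Variables (j : side) (G : list ty) (T : ty) (t : term G (TSet T)) (p : fml (T :: G)) (e : tuples G).
Variable s : state.
Hypothesis s_consistent : consistent s.
Hypothesis fex_in_s : In (Holds (fex t p) e) (items s j).

Let fex_visible : tuples_all (visible s j) G e.
Proof. exact (wf_item_visible j _ (proj1 s_consistent) fex_in_s). Qed.

Let range_visible : visible s j (TSet T) (term_tuple t e).
Proof. exact (tuple_all_term _ t e fex_visible). Qed.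

Let sat_witness A (v v' : valuation A) (y : interp A T) (x : tuple T) :
  agree (bound s) v v' -> tuple_val v' T x = y ->
  sat ((y, tuples_val v G e) : env A (T :: G)) p ->
  item_sat v' (Holds p ((x, e) : tuples (T :: G))).
Proof.
  intros Hv Hval Hp; simpl; rewrite Hval, (tuples_val_agree _ _ Hv); auto.
  revert fex_visible; apply tuples_all_impl, visible_below.
Qed.

Let fex_witness A (v : valuation A) : Forall (item_sat v) (items s j) ->
  exists y : interp A T, v (TSet T) (term_tuple t e) y /\
    sat ((y, tuples_val v G e) : env A (T :: G)) p.
Proof.
  intros Hv; destruct (sat_in _ Hv fex_in_s) as (y & Hy & Hp).
  rewrite teval_tuples_val in Hy; eauto.
Qed.

Lemma attains_shared_witness :
  owner_of (term_tuple t e) = Shared -> attains s (decomposed j (Holds (fex t p) e)).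
Proof.
  intros Ho; destruct s_consistent as (Hw & Hsc & _).
  set (l x := [Holds p ((x, e) : tuples (T :: G))]).
  apply attains_extend with (w := Shared)
    (l := fun x i => Member T x (term_tuple t e) :: pick j (l x) [] i); auto.
  - pose proof (denotable_shared Ho range_visible) as Hd.
    intros Hs; apply (separable_member (j := j) l Hw Hsc Hd (proj1 range_visible)); [|exact Hs].
    intros A v Hv; destruct (fex_witness Hv) as (y & Hy & Hp); exists y; split; auto.
    intros v' Hv' Hval; constructor; [|constructor]; exact (sat_witness _ Hv' Hval Hp).
  - intros i; constructor.
    + split; [now apply visible_fresh|].
      apply (visible_extends (extends_extend _ _ _ _)), (visible_shared _ Ho range_visible).
    + revert i; apply (Forall_pick (fun i => item_all (visible _ i))).
      constructor; [split; [now apply visible_fresh|] | constructor].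
      revert fex_visible; apply tuples_all_impl; intros B n.
      apply visible_extends, extends_extend.
  - apply mirrored_cons, mirrored_local, (Forall_pick (fun _ => local)); repeat constructor.
  - eexists; split; [now left | right; rewrite pick_same; now left].
Qed.

Lemma attains_private_witness :
  owner_of (term_tuple t e) <> Shared -> attains s (decomposed j (Holds (fex t p) e)).
Proof.
  intros Ho; destruct s_consistent as (Hw & Hsc & _).
  set (l x := [Member T x (term_tuple t e); Holds p ((x, e) : tuples (T :: G))]).
  apply attains_extend with (w := Private j) (l := fun x => pick j (l x) []); auto.
  - intros Hs; apply (separable_private (j := j) l Hw Hsc); [|exact Hs].
    intros A v Hv; destruct (fex_witness Hv) as (y & Hy & Hp); exists y.
    intros v' Hv' Hval; constructor; [|constructor; [|constructor]].
    + simpl; rewrite Hval, Hv'; [exact Hy | apply range_visible].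
    + exact (sat_witness _ Hv' Hval Hp).
  - apply (Forall_pick (fun i => item_all (visible _ i))).
    constructor; [split | constructor; [split | constructor]].
    + now apply visible_fresh.
    + apply (visible_extends (extends_extend _ _ _ _)), range_visible.
    + now apply visible_fresh.
    + revert fex_visible; apply tuples_all_impl; intros B n.
      apply visible_extends, extends_extend.
  - apply mirrored_local, (Forall_pick (fun _ => local)); repeat constructor; exact Ho.
  - simpl; rewrite pick_same; eexists; split; [now left | right; now left].
Qed.
End Witness.

Lemma attains_decomposed j it s :
  consistent s -> In it (items s j) -> attains s (decomposed j it).
Proof.
  intros Hc Hi; pose proof Hc as (Hw & _).
  pose proof (wf_item_visible j _ Hw Hi) as Hvis.
  destruct it as [|G p e]; [now apply attains_now|].
  destruct p as [| | | |a b|a b| |T t a]; try (now apply attains_now).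
  - apply attains_impl with (Q := fun s' =>
      incl [Holds a e] (items s' j) \/ incl [Holds b e] (items s' j)).
    + intros s' [H|H]; [left | right]; apply H; now left.
    + apply attains_either; [auto|repeat constructor; auto|repeat constructor|].
      intros A v Hv; destruct (sat_in _ Hv Hi); auto.
  - apply attains_impl with (Q := fun s' => incl [Holds a e; Holds b e] (items s' j)).
    + intros s' H; split; apply H; simpl; auto.
    + apply attains_all; [auto|repeat constructor; auto|repeat constructor|].
      intros A v Hv; destruct (sat_in _ Hv Hi); auto.
  - destruct (owner_of (term_tuple t e)) as [|j'] eqn:Ho.
    + now apply attains_shared_witness.
    + apply attains_private_witness; congruence.
Qed.

Lemma attains_instantiated j it m s :
  consistent s -> In it (items s j) -> In m (items s j) -> attains s (instantiated j it m).
Proof.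
  intros Hc Hit Hm; pose proof Hc as (Hw & _).
  destruct (classic (exists i, instance it m i)) as [[i Hi]|Hno].
  - apply attains_impl with (Q := fun s' => incl [i] (items s' j)).
    + intros s' H i' Hi'; rewrite (instance_functional Hi' Hi); apply H; now left.
    + apply attains_all; auto.
      * constructor; [|constructor].
        apply (item_all_instance _ Hi); now apply wf_item_visible.
      * destruct Hi; repeat constructor.
      * intros A v Hv; constructor; [|constructor].
        exact (item_sat_instance _ Hi (sat_in _ Hv Hit) (sat_in _ Hv Hm)).
  - apply attains_now; auto; intros i Hi; destruct Hno; eauto.
Qed.

Lemma attains_decided j n m s :
  consistent s -> visible s j TUr n -> visible s j TUr m -> attains s (decided j n m).
Proof.
  intros Hc Hn Hm.
  apply attains_impl with (Q := fun s' =>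
    incl [eq_item TUr n m] (items s' j) \/ incl [neq_item TUr n m] (items s' j)).
  - intros s' [H|H]; [left | right]; apply H; now left.
  - apply attains_either; [auto| |repeat constructor|].
    { constructor; [|constructor; [|constructor]]; simpl; auto. }
    intros A v _; destruct (classic (v TUr n = v TUr m)); [left | right]; auto.
Qed.
End Attainment.

Arguments consistent {U} target s.
Arguments attains {U} target s Q.

Section Tasks.
Variables (U : ty) (target : option (tuple U)) (extra : state -> list (state -> Prop)).

(* [extra] lists requirements specific to the object being collected. *)
Inductive task (s : state) : (state -> Prop) -> Prop :=
| task_decompose j it : In it (items s j) -> task s (decomposed j it)
| task_instantiate j it m :
    In it (items s j) -> In m (items s j) -> task s (instantiated j it m)
| task_decide j n m : visible s j TUr n -> visible s j TUr m -> task s (decided j n m)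
| task_extra Q : In Q (extra s) -> task s Q.

Definition names (k : nat) : list name :=
  map (fun p => Name (fst p) (snd p)) (list_prod [Shared; Private Lhs; Private Rhs] (seq 0 k)).

Lemma in_names k n : index n < k -> In n (names k).
Proof.
  destruct n as [w i]; simpl; intros H; apply in_map_iff; exists (w, i); split; auto.
  apply in_prod; [destruct w as [|[]]; simpl; auto | apply in_seq; lia].
Qed.

Lemma task_finite s : exists L, forall Q, task s Q -> In Q L.
Proof.
  set (pairs j := list_prod (items s j) (items s j)).
  set (ns := list_prod (names (bound s)) (names (bound s))).
  exists (extra s ++ flat_map (fun j =>
    map (decomposed j) (items s j) ++
    map (fun p => instantiated j (fst p) (snd p)) (pairs j) ++
    map (fun p => decided j (fst p) (snd p)) ns) [Lhs; Rhs]).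
  intros Q [j it Hi|j it m Hit Hm|j n m [Hn _] [Hm _]|Q' HQ]; apply in_or_app;
    [right|right|right|now left]; apply in_flat_map; exists j;
    (split; [destruct j; simpl; auto|]); rewrite !in_app_iff, !in_map_iff.
  - eauto.
  - right; left; exists (it, m); split; auto; now apply in_prod.
  - right; right; exists (n, m); split; auto; apply in_prod; now apply in_names.
Qed.

Hypothesis extra_stable : forall s Q, In Q (extra s) -> stable Q.
Hypothesis extra_attained : forall s Q, In Q (extra s) ->
  forall s', extends s s' -> consistent target s' -> attains target s' Q.

Lemma task_stable s Q : task s Q -> stable Q.
Proof.
  intros [j it Hi|j it m Hit Hm|j n m Hn Hm|Q' HQ].
  - apply decomposed_stable.
  - apply instantiated_stable.
  - apply decided_stable.
  - exact (extra_stable _ _ HQ).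
Qed.

Lemma task_attained s Q : task s Q ->
  forall s', extends s s' -> consistent target s' -> attains target s' Q.
Proof.
  intros HQ s' Hs Hc; pose proof (proj2 (proj2 Hs)) as Hincl.
  destruct HQ as [j it Hi|j it m Hit Hm|j n m Hn Hm|Q' HQ].
  - apply attains_decomposed; auto; now apply Hincl.
  - apply attains_instantiated; auto; now apply Hincl.
  - apply attains_decided; eauto using visible_extends.
  - exact (extra_attained _ HQ Hs Hc).
Qed.

Record saturation (ch : nat -> state) : Prop := Saturation {
  saturation_consistent : forall n, consistent target (ch n);
  saturation_extends : forall n m, n <= m -> extends (ch n) (ch m);
  saturation_fair : forall n Q, task (ch n) Q -> Q (ch (S n)) }.

Lemma saturation_exists s : consistent target s -> exists ch, ch 0 = s /\ saturation ch.
Proof.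
  intros Hs.
  destruct (fair_chain extends (consistent target) task extends_refl extends_trans
    task_finite task_stable task_attained s Hs) as (ch & H0 & Hc & Hle & Hfair).
  now exists ch.
Qed.
End Tasks.

Arguments saturation {U} target extra ch.

(** * The model of a saturated chain *)

Inductive component {A U} (z : interp A U) : forall T, interp A T -> Prop :=
| component_self : component z U z
| component_fst T1 T2 (p : interp A (TProd T1 T2)) :
    component z (TProd T1 T2) p -> component z T1 (fst p)
| component_snd T1 T2 (p : interp A (TProd T1 T2)) :
    component z (TProd T1 T2) p -> component z T2 (snd p)
| component_element T (S : interp A (TSet T)) (y : interp A T) :
    component z (TSet T) S -> S y -> component z T y.

Section Model.
Variables (U : ty) (target : option (tuple U)) (extra : state -> list (state -> Prop)).
Variable ch : nat -> state.
Hypothesis ch_saturated : saturation target extra ch.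

Definition holds (j : side) (it : item) : Prop := exists n, In it (items (ch n) j).
Definition known (j : side) (T : ty) (n : name) : Prop := exists i, visible (ch i) j T n.

Lemma in_chain_later n m j it : n <= m -> In it (items (ch n) j) -> In it (items (ch m) j).
Proof. intros H; now apply (saturation_extends ch_saturated H). Qed.

Lemma visible_later n m j T x : n <= m -> visible (ch n) j T x -> visible (ch m) j T x.
Proof. intros H; apply visible_extends, (saturation_extends ch_saturated H). Qed.

Lemma holds_common j l : Forall (holds j) l -> exists n, incl l (items (ch n) j).
Proof.
  induction 1 as [|it l [n Hn] _ [m Hm]].
  - exists 0; intros it [].
  - exists (n + m); intros it' [<-|Hi].
    + apply (in_chain_later j it (Nat.le_add_r n m) Hn).
    + apply (in_chain_later j it' (Nat.le_add_l m n) (Hm _ Hi)).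
Qed.

Lemma holds_visible j it : holds j it -> exists n, item_all (visible (ch n) j) it.
Proof.
  intros [n Hn]; exists n; destruct (saturation_consistent ch_saturated n) as (Hw & _).
  exact (wf_item_visible j _ Hw Hn).
Qed.

Lemma holds_satisfiable j l :
  Forall (holds j) l -> exists A (v : valuation A), Forall (item_sat v) l.
Proof.
  intros H; destruct (holds_common H) as [n Hn].
  apply NNPP; intros Hno; destruct (saturation_consistent ch_saturated n) as (_ & _ & Hns).
  apply Hns, separable_unsat with (j := j); intros A v Hv.
  apply Hno; exists A, v; exact (incl_Forall Hn Hv).
Qed.

Definition equated (j : side) (n m : name) : Prop := holds j (eq_item TUr n m).

Lemma equated_or_apart j n m :
  known j TUr n -> known j TUr m -> equated j n m \/ holds j (neq_item TUr n m).
Proof.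
  intros [a Ha] [b Hb].
  apply (visible_later (Nat.le_add_r a b)) in Ha; apply (visible_later (Nat.le_add_l b a)) in Hb.
  destruct (saturation_fair ch_saturated _ (task_decide extra Ha Hb)) as [H|H].
  - left; now exists (S (a + b)).
  - right; now exists (S (a + b)).
Qed.

Lemma equated_of_entailed j l n m : known j TUr n -> known j TUr m -> Forall (holds j) l ->
  (forall A (v : valuation A), Forall (item_sat v) l -> v TUr n = v TUr m) -> equated j n m.
Proof.
  intros Hn Hm Hl H; destruct (equated_or_apart Hn Hm) as [|Hneq]; auto.
  destruct (holds_satisfiable (Forall_cons _ Hneq Hl)) as (A & v & Hv).
  inversion_clear Hv as [|? ? Hapart Hsat]; destruct Hapart; exact (H A v Hsat).
Qed.

Lemma equated_known j n m : equated j n m -> known j TUr n /\ known j TUr m.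
Proof. intros H; destruct (holds_visible H) as (i & Hn & Hm & _); split; now exists i. Qed.

Lemma equated_refl j n : known j TUr n -> equated j n n.
Proof. intros Hn; now apply equated_of_entailed with (l := []). Qed.

Lemma equated_sym j n m : equated j n m -> equated j m n.
Proof.
  intros H; destruct (equated_known H).
  apply equated_of_entailed with (l := [eq_item TUr n m]); auto.
  intros A v Hv; inversion_clear Hv; now symmetry.
Qed.

Lemma equated_trans j n m p : equated j n m -> equated j m p -> equated j n p.
Proof.
  intros Hnm Hmp; destruct (equated_known Hnm), (equated_known Hmp).
  apply equated_of_entailed with (l := [eq_item TUr n m; eq_item TUr m p]); auto.
  intros A v Hv; inversion_clear Hv as [|? ? E1 Hv']; inversion_clear Hv' as [|? ? E2 _].
  exact (eq_trans E1 E2).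
Qed.

Lemma denotable_of_known i j j' T n :
  j' <> j -> visible (ch i) j T n -> known j' T n -> denotable (ch i) T n.
Proof.
  intros Hj [_ Hn] (i' & _ & Hn'); destruct (owner_of n); congruence.
Qed.

Lemma equated_transfer j j' n m :
  equated j n m -> known j' TUr n -> known j' TUr m -> equated j' n m.
Proof.
  intros [a Ha] Hn Hm; destruct (side_eq_dec j' j) as [->|Hj]; [now exists a|].
  destruct (equated_or_apart Hn Hm) as [|[b Hb]]; auto; exfalso.
  apply (in_chain_later _ _ (Nat.le_add_r a b)) in Ha.
  apply (in_chain_later _ _ (Nat.le_add_l b a)) in Hb.
  destruct (saturation_consistent ch_saturated (a + b)) as (Hw & _ & Hns).
  destruct (wf_item_visible j _ Hw Ha) as (Hn' & Hm' & _).
  apply Hns, separable_clash with (1 := Hj) (n := n) (m := m); auto;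
    eapply denotable_of_known; eauto.
Qed.

(* Equality of atoms across the two sides always passes through a shared name. *)
Definition linked (n m : name) : Prop :=
  exists j j' c, equated j n c /\ equated j' c m.

Lemma linked_step j n m p : equated j n m -> linked m p -> linked n p.
Proof.
  intros Hnm (j1 & j2 & c & Hmc & Hcp).
  destruct (side_eq_dec j1 j) as [->|H1]; [|destruct (side_eq_dec j2 j) as [->|H2]].
  - exists j, j2, c; split; [eapply equated_trans|]; eassumption.
  - exists j, j, c; split; [|exact Hcp].
    apply (equated_trans Hnm), (equated_transfer Hmc); [apply (equated_known Hnm) |].
    apply (equated_known Hcp).
  - replace j2 with j1 in Hcp by (destruct j, j1, j2; congruence).
    exists j, j1, m; split; [exact Hnm | eapply equated_trans; eassumption].
Qed.

Lemma linked_equated j n m : known j TUr n -> known j TUr m -> linked n m -> equated j n m.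
Proof.
  intros Hn Hm (j1 & j2 & c & Hnc & Hcm).
  destruct (side_eq_dec j1 j2) as [<-|Hne].
  - exact (equated_transfer (equated_trans Hnc Hcm) Hn Hm).
  - assert (Hc : known j TUr c).
    { destruct (equated_known Hnc) as [_ H1], (equated_known Hcm) as [H2 _].
      destruct j, j1, j2; easy. }
    apply (@equated_trans j n c m); eapply equated_transfer; eassumption.
Qed.

Lemma linked_refl j n : known j TUr n -> linked n n.
Proof. intros H; exists j, j, n; split; now apply equated_refl. Qed.

Lemma linked_eq_iff j n m :
  known j TUr n -> known j TUr m -> (linked n = linked m <-> equated j n m).
Proof.
  intros Hn Hm; split.
  - intros E; apply linked_equated; auto; rewrite E; exact (linked_refl Hm).
  - intros H; apply pred_ext; intros p; split; apply linked_step with (j := j); auto.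
    now apply equated_sym.
Qed.

(* The atoms of the model are the classes of [linked], as predicates. *)
Fixpoint collapse (T : ty) : tuple T -> interp (name -> Prop) T :=
  match T with
  | TUr => linked
  | TUnit => fun _ => tt
  | TProd T1 T2 => fun x => (collapse T1 (fst x), collapse T2 (snd x))
  | TSet T' => fun t y => exists x, (exists j, holds j (Member T' x t)) /\ y = collapse T' x
  end.

Definition model : valuation (name -> Prop) :=
  fun T =>
    match T with
    | TUr => linked
    | TUnit => fun _ => tt
    | TProd T1 T2 => fun _ => dflt (fun _ => False) (TProd T1 T2)
    | TSet T' => collapse (TSet T')
    end.

Lemma tuple_val_model T (x : tuple T) : tuple_val model T x = collapse T x.
Proof.
  induction T as [| |T1 IH1 T2 IH2|T _]; simpl; auto.
  now rewrite IH1, IH2.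
Qed.

Lemma holds_member_transfer j j' T x t :
  holds j' (Member T x t) -> known j (TSet T) t -> holds j (Member T x t).
Proof.
  intros [n Hn] (i & _ & Ht); destruct (saturation_consistent ch_saturated n) as (Hw & _).
  destruct (wf_item_visible j' _ Hw Hn) as (_ & _ & Ht'); exists n.
  destruct (owner_of t) as [|j''] eqn:Ho.
  - exact (wf_mirrored Hw j' j T x t Ho Hn).
  - replace j with j' by congruence; exact Hn.
Qed.

Lemma known_term j n G (t : term G TUr) (e : tuples G) :
  tuples_all (visible (ch n) j) G e -> known j TUr (term_tuple t e).
Proof. intros He; exists n; exact (tuple_all_term _ t e He). Qed.

Lemma sat_feq_model j G (t u : term G TUr) (e : tuples G) :
  holds j (Holds (feq t u) e) -> sat (tuples_val model G e) (feq t u).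
Proof.
  intros H; destruct (holds_visible H) as [n He]; simpl; rewrite !teval_tuples_val.
  apply (linked_eq_iff (known_term _ _ t _ He) (known_term _ _ u _ He)).
  apply equated_of_entailed with (l := [Holds (feq t u) e]); eauto using known_term.
  intros A v Hv; inversion_clear Hv as [|? ? E _].
  simpl in E; now rewrite !teval_tuples_val in E.
Qed.

Lemma sat_fneq_model j G (t u : term G TUr) (e : tuples G) :
  holds j (Holds (fneq t u) e) -> sat (tuples_val model G e) (fneq t u).
Proof.
  intros H; destruct (holds_visible H) as [n He]; simpl; rewrite !teval_tuples_val; intros E.
  apply (linked_eq_iff (known_term _ _ t _ He) (known_term _ _ u _ He)) in E.
  assert (Hl : Forall (holds j)
    [Holds (fneq t u) e; eq_item TUr (term_tuple t e) (term_tuple u e)]) by auto.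
  destruct (holds_satisfiable Hl) as (A & v & Hv).
  inversion_clear Hv as [|? ? Hapart Hv']; inversion_clear Hv' as [|? ? Heq _].
  simpl in Hapart; rewrite !teval_tuples_val in Hapart; exact (Hapart Heq).
Qed.

Lemma holds_decomposed j it : holds j it -> exists n, decomposed j it (ch n).
Proof.
  intros [n Hn]; exists (S n).
  exact (saturation_fair ch_saturated _ (task_decompose extra _ _ _ Hn)).
Qed.

Lemma holds_instance j it m i : instance it m i -> holds j it -> holds j m -> holds j i.
Proof.
  intros Hi [a Ha] [b Hb]; exists (S (a + b)).
  refine (saturation_fair ch_saturated _ (task_instantiate extra _ _ it m _ _) i Hi).
  - exact (in_chain_later _ _ (Nat.le_add_r a b) Ha).
  - exact (in_chain_later _ _ (Nat.le_add_l b a) Hb).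
Qed.

Lemma model_sat_formula G (p : fml G) :
  forall j (e : tuples G), holds j (Holds p e) -> sat (tuples_val model G e) p.
Proof.
  induction p as [G t u|G t u|G|G|G a IHa b IHb|G a IHa b IHb|G T t a IHa|G T t a IHa];
    intros j e H; simpl.
  - exact (sat_feq_model H).
  - exact (sat_fneq_model H).
  - exact I.
  - destruct (holds_satisfiable (Forall_cons _ H (Forall_nil _))) as (A & v & Hv).
    now inversion_clear Hv.
  - destruct (holds_decomposed H) as [n [Hn|Hn]]; [left | right].
    + apply (IHa j); now exists n.
    + apply (IHb j); now exists n.
  - destruct (holds_decomposed H) as [n [Ha Hb]].
    split; [apply (IHa j) | apply (IHb j)]; now exists n.
  - intros y; rewrite teval_tuples_val, tuple_val_model; intros (x & [j' Hx] & ->).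
    rewrite <- tuple_val_model; apply (IHa j (x, e)).
    apply (holds_instance (Instance t a e x) H); apply holds_member_transfer with (1 := Hx).
    destruct (holds_visible H) as [n Hn]; exists n; exact (tuple_all_term _ t e Hn).
  - destruct (holds_decomposed H) as (n & x & Hx & Ha); exists (tuple_val model T x); split.
    + rewrite teval_tuples_val, (tuple_val_model (TSet T)), tuple_val_model.
      exists x; split; auto; exists j; now exists n.
    + apply (IHa j (x, e)); now exists n.
Qed.

Lemma model_sat j it : holds j it -> item_sat model it.
Proof.
  destruct it as [T x t|G p e]; intros H; [|exact (model_sat_formula H)].
  exists x; rewrite tuple_val_model; eauto.
Qed.

Lemma model_satisfies n : satisfies model (ch n).
Proof.
  intros j; apply Forall_forall; intros it Hi; apply (model_sat (j := j)); now exists n.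
Qed.

Lemma component_known j V (o : tuple V) T (y : interp (name -> Prop) T) :
  tuple_all (known j) V o -> component (tuple_val model V o) T y ->
  exists w : tuple T, tuple_all (known j) T w /\ y = tuple_val model T w.
Proof.
  intros Ho; induction 1 as [|T1 T2 p _ (w & [Hw _] & ->)|T1 T2 p _ (w & [_ Hw] & ->)
    |T S y _ (t & Ht & ->) Hy].
  - now exists o.
  - now exists (fst w).
  - now exists (snd w).
  - destruct Hy as (x & [j' Hx] & ->); exists x; split; [|symmetry; apply tuple_val_model].
    destruct (holds_visible (holds_member_transfer Hx Ht)) as (n & Hn & _).
    revert Hn; apply tuple_all_impl; intros B m Hm; now exists n.
Qed.

Lemma linked_shared r w : known Lhs TUr r -> known Rhs TUr w -> linked r w ->
  exists c, equated Lhs r c /\ known Rhs TUr c.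
Proof.
  intros Hr Hw (j & j' & c & Hrc & Hcw).
  destruct j.
  - destruct j'; [exists w | exists c]; split; auto.
    + eapply equated_trans; eassumption.
    + apply (equated_known Hcw).
  - exists r; split; [now apply equated_refl | apply (equated_known Hrc)].
Qed.
End Model.

(** * Collecting the components of right-hand objects *)

Lemma saturation_exists_nil U (target : option (tuple U)) s :
  consistent target s -> exists ch, ch 0 = s /\ saturation target (fun _ => []) ch.
Proof. apply saturation_exists; intros _ Q []. Qed.

Lemma separable_of_unsat s :
  wf s -> (forall A (v : valuation A), ~ satisfies v s) -> separable (U := TUnit) None s.
Proof.
  intros Hw Hunsat; apply NNPP; intros Hns.
  assert (Hc : consistent (U := TUnit) None s) by (repeat split; auto; apply Hw).
  destruct (saturation_exists_nil Hc) as (ch & <- & Hch).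
  exact (Hunsat _ _ (model_satisfies Hch 0)).
Qed.

Lemma separable_atom s (r : name) V (o : tuple V) :
  wf s -> visible s Lhs TUr r -> tuple_all (visible s Rhs) V o ->
  (forall A (v : valuation A), satisfies v s -> component (tuple_val v V o) TUr (v TUr r)) ->
  separable (U := TUr) (Some r) s.
Proof.
  intros Hw Hr Ho Hcomp; apply NNPP; intros Hns.
  assert (Hc : consistent (U := TUr) (Some r) s) by (split; auto).
  destruct (saturation_exists_nil Hc) as (ch & <- & Hch).
  destruct (component_known Hch Rhs (V := V) o (T := TUr) (y := model ch TUr r))
    as (w & Hw' & Erw).
  - revert Ho; apply tuple_all_impl; intros B n Hn; now exists 0.
  - apply Hcomp, (model_satisfies Hch 0).
  - destruct (linked_shared Hch (r := r) (w := w)) as (c & [n Hn] & Hc'); auto.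
    + now exists 0.
    + change (linked ch r w); simpl in Erw; rewrite Erw; exact (linked_refl Hch Hw').
    + destruct (saturation_consistent Hch n) as (Hwn & _ & Hnsn).
      destruct (wf_item_visible Lhs _ Hwn Hn) as (_ & Hcv & _).
      apply Hnsn, separable_shared_atom with (1 := Hn).
      apply denotable_of_known with (2 := Hcv) (3 := Hc'); discriminate.
Qed.

Definition distinguished (T : ty) (r w : name) (s : state) : Prop :=
  exists (z : tuple T) (b : bool),
    In (membership_item b T z r) (items s Lhs) /\ In (membership_item (negb b) T z w) (items s Rhs).

Lemma distinguished_stable T r w : stable (distinguished T r w).
Proof. intros s s' (_ & _ & H) (z & b & Hz & Hw); exists z, b; split; now apply H. Qed.

Lemma distinguished_sat A (v : valuation A) T r w s :
  satisfies v s -> distinguished T r w s -> v (TSet T) r <> v (TSet T) w.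
Proof.
  intros Hv (z & b & Hz & Hw) E.
  apply (sat_in _ (Hv Lhs)), sat_membership_item in Hz; rewrite E in Hz.
  apply (sat_in _ (Hv Rhs)), sat_membership_item in Hw.
  destruct b; simpl in Hz, Hw; auto.
Qed.

Lemma confined_stable T r c : stable (confined T r c).
Proof.
  intros s s' Hs (Hsub & Ho & Hc); split; [now apply Hs | split; [exact Ho|]].
  exact (visible_extends Hs Hc).
Qed.

Lemma attains_distinguished T s (r w c : name) :
  consistent (U := TSet T) (Some r) s -> confined T r c s -> visible s Rhs (TSet T) w ->
  attains (U := TSet T) (Some r) s (distinguished T r w).
Proof.
  intros Hcons Hconf Hwv; pose proof Hcons as (Hw & Hr & Hns); simpl in Hr.
  assert (Hb : exists b, ~ separable (U := TSet T) (Some r) (distinguish b T r w c s)).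
  { apply NNPP; intros Hno; apply Hns, (separable_distinguish Hw Hr (proj1 Hwv) Hconf).
    intros b; apply NNPP; eauto. }
  destruct Hb as [b Hb], Hconf as (_ & Ho & Hc).
  assert (Hext : extends s (distinguish b T r w c s)) by apply extends_extend.
  apply attains_extend with (w := Shared) (l := fun z j => Member T z c ::
    pick Lhs [membership_item b T z r] [membership_item (negb b) T z w] j); auto.
  - contradiction.
  - assert (Hz : forall j, tuple_all (visible (distinguish b T r w c s) j) T
      (fresh Shared T (bound s))) by (intros j; now apply visible_fresh).
    intros j; constructor; [|destruct j; (constructor; [|constructor])]; split; auto.
    + exact (visible_extends Hext (visible_shared j Ho Hc)).
    + split; [exact (visible_extends Hext Hr) | exact I].
    + split; [exact (visible_extends Hext Hwv) | exact I].
  - apply mirrored_cons, mirrored_local; intros []; repeat constructor.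
  - exists (fresh Shared T (bound s)), b; simpl; auto.
Qed.

Definition distinguishing (T : ty) (r c : name) (s : state) : list (state -> Prop) :=
  map (fun w s' => confined T r c s -> visible s Rhs (TSet T) w -> distinguished T r w s')
    (names (bound s)).

Lemma in_distinguishing T r c s w : index w < bound s ->
  In (fun s' => confined T r c s -> visible s Rhs (TSet T) w -> distinguished T r w s')
    (distinguishing T r c s).
Proof. intros Hw; apply in_map_iff; exists w; split; [reflexivity | now apply in_names]. Qed.

Lemma distinguishing_stable T r c s Q : In Q (distinguishing T r c s) -> stable Q.
Proof.
  intros HQ; apply in_map_iff in HQ as (w & <- & _); intros s1 s2 H12 H1 Hc Hw.
  exact (distinguished_stable H12 (H1 Hc Hw)).
Qed.

Lemma distinguishing_attained T r c s Q : In Q (distinguishing T r c s) ->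
  forall s', extends s s' -> consistent (U := TSet T) (Some r) s' ->
  attains (U := TSet T) (Some r) s' Q.
Proof.
  intros HQ s' Hs Hc; apply in_map_iff in HQ as (w & <- & _).
  destruct (classic (confined T r c s /\ visible s Rhs (TSet T) w)) as [[Hconf Hw]|Hno].
  - apply attains_impl with (Q := distinguished T r w); auto.
    apply attains_distinguished with (c := c); auto.
    + exact (confined_stable Hs Hconf).
    + exact (visible_extends Hs Hw).
  - apply attains_now; auto; tauto.
Qed.

(* Otherwise [r] would have, in the model of a saturated chain, the same elements as some
   right-hand name, although it has been distinguished from it. *)
Lemma separable_set T s (r c : name) V (o : tuple V) :
  wf s -> visible s Lhs (TSet T) r -> tuple_all (visible s Rhs) V o -> confined T r c s ->
  (forall A (v : valuation A), satisfies v s ->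
     component (tuple_val v V o) (TSet T) (v (TSet T) r)) ->
  separable (U := TSet T) (Some r) s.
Proof.
  intros Hw Hr Ho Hconf Hcomp; apply NNPP; intros Hns.
  assert (Hc : consistent (U := TSet T) (Some r) s) by (split; auto).
  destruct (saturation_exists (distinguishing T r c) (@distinguishing_stable T r c)
    (@distinguishing_attained T r c) Hc) as (ch & <- & Hch).
  destruct (component_known Hch Rhs (V := V) o (T := TSet T) (y := model ch (TSet T) r))
    as (w & [n Hwn] & Erw).
  - revert Ho; apply tuple_all_impl; intros B n Hn; now exists 0.
  - apply Hcomp, (model_satisfies Hch 0).
  - apply (distinguished_sat (T := T) (r := r) (w := w) (model_satisfies Hch (S n)));
      [|exact Erw].
    pose proof (in_distinguishing T r c _ _ (proj1 Hwn)) as Hd.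
    apply (saturation_fair Hch n (task_extra _ _ _ Hd)); [|exact Hwn].
    exact (confined_stable (saturation_extends Hch (Nat.le_0_l n)) Hconf).
Qed.

Definition collected (T : ty) (s : state) (r : tuple T) : Prop :=
  exists E : expr (ctx s) (TSet T), forall A (u0 : A) (v : valuation A),
    satisfies v s -> eeval u0 E (shared_env v s) (tuple_val v T r).

Lemma collected_of_separable U s (r : tuple U) : separable (Some r) s -> collected U s r.
Proof.
  intros (E & th & Hth & Hexcl); exists E; intros A u0 v Hv; apply NNPP; intros Hn.
  apply (Hexcl A u0 (shared_env v s)); intros j; exact (Hth A u0 v j (Hv j) Hn).
Qed.

Lemma collected_product T1 T2 s (r : tuple (TProd T1 T2)) :
  collected T1 s (fst r) -> collected T2 s (snd r) -> collected (TProd T1 T2) s r.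
Proof.
  intros [E1 H1] [E2 H2]; exists (eproduct E1 E2); intros A u0 v Hv.
  apply eeval_eproduct; auto.
Qed.

Definition private_element (T : ty) (r : name) : state -> state :=
  extend (Private Lhs) T (fun x => pick Lhs [membership_item true T x r] []).

Lemma wf_private_element T r s :
  wf s -> visible s Lhs (TSet T) r -> wf (private_element T r s).
Proof.
  intros Hw Hr; apply wf_extend; [exact Hw | |].
  - apply (Forall_pick (fun i => item_all (visible _ i))); constructor; [|constructor].
    split; [now apply visible_fresh | split; [|exact I]].
    exact (visible_extends (extends_extend _ _ _ _) Hr).
  - apply mirrored_local; intros []; repeat constructor.
Qed.

(* A private element of [r] is an arbitrary one, so collecting it collects all of them. *)
Lemma collected_elements T s (r : name) :
  wf s -> visible s Lhs (TSet T) r ->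
  collected T (private_element T r s) (fresh (Private Lhs) T (bound s)) ->
  exists C : expr (ctx s) (TSet T), forall A (u0 : A) (v : valuation A) (y : interp A T),
    satisfies v s -> v (TSet T) r y -> eeval u0 C (shared_env v s) y.
Proof.
  intros Hw Hr [C HC]; exists C; intros A u0 v y Hv Hy.
  destruct (fresh_assignable v T (bound s) y) as (v' & Hv' & Hval); specialize (Hval (Private Lhs)).
  rewrite <- (shared_env_agree Hw Hv'), <- Hval; apply HC.
  apply satisfies_extend; split; [exact (satisfies_agree Hw Hv' Hv)|].
  apply (Forall_pick (fun _ => item_sat v')).
  constructor; [|constructor]; apply sat_membership_item; simpl.
  rewrite Hval, Hv'; [exact Hy | apply Hr].
Qed.

Definition shared_superset (T : ty) (r : name) : state -> state :=
  extend Shared (TSet T) (fun c => pick Lhs [subset_item T r c] []).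

Lemma wf_shared_superset T r s :
  wf s -> visible s Lhs (TSet T) r -> wf (shared_superset T r s).
Proof.
  intros Hw Hr; apply wf_extend; [exact Hw | |].
  - apply (Forall_pick (fun i => item_all (visible _ i))); constructor; [|constructor].
    split; [|split; [|exact I]].
    + exact (visible_extends (extends_extend _ _ _ _) Hr).
    + now apply (visible_fresh Shared (TSet T)).
  - apply mirrored_local; intros []; repeat constructor.
Qed.

Lemma collected_subset T s (r : name) (C : expr (ctx s) (TSet T)) :
  wf s -> visible s Lhs (TSet T) r ->
  (forall A (u0 : A) (v : valuation A) (y : interp A T),
     satisfies v s -> v (TSet T) r y -> eeval u0 C (shared_env v s) y) ->
  collected (TSet T) (shared_superset T r s) r -> collected (TSet T) s r.
Proof.
  intros Hw Hr HC [E HE]; exists (ebigunion E (esing C)); intros A u0 v Hv.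
  destruct (fresh_assignable v (TSet T) (bound s) (eeval u0 C (shared_env v s)))
    as (v' & Hv' & Hval).
  specialize (Hval Shared); apply eeval_ebigunion.
  exists (eeval u0 C (shared_env v s)); split; [reflexivity|].
  specialize (HE A u0 v'); unfold shared_superset in HE.
  rewrite (shared_env_extend _ _ Hw Hv' Hval), (visible_val_agree s Lhs (TSet T) _ Hv' Hr) in HE.
  apply HE, satisfies_extend; split; [exact (satisfies_agree Hw Hv' Hv)|].
  apply (Forall_pick (fun _ => item_sat v')).
  constructor; [|constructor]; apply sat_subset_item; intros y Hy.
  change (tuple_val v' (TSet T) (fresh Shared (TSet T) (bound s)) y); rewrite Hval.
  apply HC; auto; rewrite <- (Hv' _ r); [exact Hy | apply Hr].
Qed.

Theorem collected_component T : forall s (r : tuple T) V (o : tuple V),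
  wf s -> tuple_all (visible s Lhs) T r -> tuple_all (visible s Rhs) V o ->
  (forall A (v : valuation A), satisfies v s ->
     component (tuple_val v V o) T (tuple_val v T r)) ->
  collected T s r.
Proof.
  induction T as [| |T1 IH1 T2 IH2|T IH]; intros s r V o Hw Hr Ho Hcomp.
  - eapply collected_of_separable, separable_atom; eauto.
  - exists (esing (eunit _)); intros A u0 v _; reflexivity.
  - destruct Hr as [Hr1 Hr2]; apply collected_product.
    + apply (IH1 s _ V o); auto; intros A v Hv; exact (component_fst (Hcomp A v Hv)).
    + apply (IH2 s _ V o); auto; intros A v Hv; exact (component_snd (Hcomp A v Hv)).
  - assert (Ho' : forall w S l, tuple_all (visible (extend w S l s) Rhs) V o).
    { intros w S l; exact (tuple_visible_extends _ _ _ (extends_extend _ _ _ _) Ho). }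
    destruct (collected_elements (r := r) Hw Hr) as [C HC].
    { apply (IH _ _ V o); [now apply wf_private_element | now apply visible_fresh | apply Ho' |].
      intros A v Hv; apply satisfies_extend in Hv as [Hv Hl].
      apply component_element with (S := v (TSet T) r); [exact (Hcomp A v Hv)|].
      specialize (Hl Lhs); inversion_clear Hl as [|? ? Hx _].
      now apply sat_membership_item in Hx. }
    apply (collected_subset (r := r) C Hw Hr HC), collected_of_separable.
    apply separable_set with (c := Name Shared (bound s)) (V := V) (o := o).
    + now apply wf_shared_superset.
    + exact (visible_extends (extends_extend _ _ _ _) Hr).
    + apply Ho'.
    + split; [now left | split; [reflexivity|]].
      now apply (visible_fresh Shared (TSet T)).
    + intros A v Hv; apply satisfies_extend in Hv as [Hv _]; exact (Hcomp A v Hv).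
Qed.

(** * Explicit definitions *)

Definition compared (T : ty) (a b : tuple T) : state -> state :=
  extend Shared T (fun z => pick Lhs [eq_item T z a] [neq_item T z b]).

Lemma wf_compared T s (a b : tuple T) :
  wf s -> tuple_all (visible s Lhs) T a -> tuple_all (visible s Rhs) T b -> wf (compared T a b s).
Proof.
  intros Hw Ha Hb; apply wf_extend; [exact Hw | |].
  - intros []; (constructor; [|constructor]); (split; [now apply visible_fresh|]);
      (split; [|exact I]); apply (tuple_visible_extends _ _ _ (extends_extend _ _ _ _)); assumption.
  - apply mirrored_local; intros []; repeat constructor.
Qed.

Lemma singleton_test T s (a b : tuple T) :
  wf s -> tuple_all (visible s Lhs) T a -> tuple_all (visible s Rhs) T b ->
  (forall A (v : valuation A), satisfies v s -> tuple_val v T a = tuple_val v T b) ->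
  exists th : bexpr (T :: ctx s), forall A (u0 : A) (v : valuation A) (y : interp A T),
    satisfies v s ->
    (test u0 th ((y, shared_env v s) : env A (T :: ctx s)) <-> y = tuple_val v T a).
Proof.
  intros Hw Ha Hb Hab.
  destruct (separable_of_unsat (wf_compared _ _ _ Hw Ha Hb)) as (E & th & Hth & Hexcl).
  { intros A v Hv; apply satisfies_extend in Hv as [Hv Hz].
    pose proof (Hz Lhs) as Heq; pose proof (Hz Rhs) as Hneq.
    inversion_clear Heq as [|? ? Heq' _]; inversion_clear Hneq as [|? ? Hneq' _].
    apply sat_eq_item in Heq'; apply sat_neq_item in Hneq'.
    apply Hneq'; rewrite Heq'; auto. }
  simpl in th; exists (th Lhs); intros A u0 v y Hv.
  destruct (fresh_assignable v T (bound s) y) as (v' & Hv' & Hval); specialize (Hval Shared).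
  specialize (Hth A u0 v'); unfold compared in Hth.
  rewrite (shared_env_extend _ _ Hw Hv' Hval) in Hth.
  assert (Hside : forall j,
    item_sat v' (pick Lhs (eq_item T (fresh Shared T (bound s)) a)
      (neq_item T (fresh Shared T (bound s)) b) j) ->
    test u0 (th j) ((y, shared_env v s) : env A (T :: ctx s))).
  { intros j Hj; apply Hth; [|intros []]; apply Forall_app; split.
    - destruct j; constructor; auto.
    - exact (satisfies_agree Hw Hv' Hv j). }
  assert (Ea : tuple_val v' T a = tuple_val v T a).
  { exact (visible_val_agree _ _ _ _ Hv' Ha). }
  assert (Eb : tuple_val v' T b = tuple_val v T a).
  { rewrite (Hab A v Hv); exact (visible_val_agree _ _ _ _ Hv' Hb). }
  split.
  - intros Hy; apply NNPP; intros Hne; apply (Hexcl A u0 (y, shared_env v s)); intros [].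
    + exact Hy.
    + apply Hside, sat_neq_item; now rewrite Hval, Eb.
  - intros ->; apply Hside, sat_eq_item; now rewrite Hval, Ea.
Qed.

Lemma get_sem_singleton A (u0 : A) T (S : interp A T -> Prop) (x : interp A T) :
  (forall y, S y <-> y = x) -> get_sem u0 S = x.
Proof.
  intros H; unfold get_sem; destruct excluded_middle_informative as [Hex|Hno].
  - apply H; destruct constructive_indefinite_description as [y Hy]; apply Hy.
  - destruct Hno; exists x; split; [now apply H | intros y Hy; symmetry; now apply H].
Qed.

Theorem explicit_of_equal T s (a b : tuple T) :
  wf s -> tuple_all (visible s Lhs) T a -> tuple_all (visible s Rhs) T b ->
  (forall A (v : valuation A), satisfies v s -> tuple_val v T a = tuple_val v T b) ->
  exists E : expr (ctx s) T, forall A (u0 : A) (v : valuation A),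
    satisfies v s -> eeval u0 E (shared_env v s) = tuple_val v T a.
Proof.
  intros Hw Ha Hb Hab.
  destruct (collected_component (T := T) a (V := T) b Hw) as [C HC]; auto.
  { intros A v Hv; rewrite (Hab A v Hv); apply component_self. }
  destruct (singleton_test T a b Hw Ha Hb Hab) as [th Hth].
  exists (eget (efilter th C)); intros A u0 v Hv; apply get_sem_singleton; intros y.
  rewrite eeval_efilter, (Hth A u0 v y Hv); split; [now intros [_ ->]|].
  intros ->; auto.
Qed.

Section Doubling.
Variables (Tin Tout : ty) (As : list ty) (Sigma : fml (Tin :: Tout :: As)).

Definition output (j : side) : tuple Tout := fresh (Private j) Tout (size Tin).

Definition copy (j : side) : tuples (Tin :: Tout :: As) :=
  (fresh Shared Tin 0, freshes (Private j) (Tout :: As) (size Tin)).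

Definition doubled : state :=
  {| bound := sizes (Tin :: Tout :: As);
     ctx := [Tin];
     shared := (fresh Shared Tin 0, tt);
     items := fun j => [Holds Sigma (copy j)] |}.

Lemma visible_copy j : tuples_all (visible doubled j) (Tin :: Tout :: As) (copy j).
Proof.
  split.
  - apply tuple_visible_shared.
    + apply tuple_all_denotable with (e := evar (VZ _ _)); reflexivity.
    + apply tuple_all_fresh; simpl; split; [lia | reflexivity].
  - apply tuples_all_freshes; intros B n Hn; split; [|reflexivity].
    simpl in *; lia.
Qed.

Lemma visible_output j : tuple_all (visible doubled j) Tout (output j).
Proof. exact (proj1 (proj2 (visible_copy j))). Qed.

Lemma wf_doubled : wf doubled.
Proof.
  split.
  - intros j; constructor; [exact (visible_copy j) | constructor].
  - apply mirrored_local; intros j; repeat constructor.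
  - split; [|exact I]; generalize (proj1 (visible_copy Lhs)).
    apply tuple_all_impl, visible_below.
Qed.

Lemma doubled_functional A (v : valuation A) : implicitly_defines Sigma ->
  satisfies v doubled -> tuple_val v Tout (output Lhs) = tuple_val v Tout (output Rhs).
Proof.
  intros Himp Hv; pose proof (Hv Lhs) as HL; pose proof (Hv Rhs) as HR.
  inversion_clear HL as [|? ? HL' _]; inversion_clear HR as [|? ? HR' _].
  exact (Himp _ _ _ _ _ _ HL' HR').
Qed.

Lemma doubled_satisfiable A (u0 : A) (i : interp A Tin) (o : interp A Tout) (a : env A As) :
  sat ((i, (o, a)) : env A (Tin :: Tout :: As)) Sigma ->
  exists v : valuation A, satisfies v doubled /\
    shared_env v doubled = (i, tt) /\ tuple_val v Tout (output Lhs) = o.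
Proof.
  intros Hsat.
  destruct (freshes_assignable (fun T _ => dflt u0 T) (Tin :: Tout :: As) 0 (i, (o, a)))
    as (v & _ & Hv).
  assert (Hcopy : forall j, tuples_val v (Tin :: Tout :: As) (copy j) = (i, (o, a))).
  { intros j; pose proof (Hv Shared) as HS; pose proof (Hv (Private j)) as HP.
    simpl in *; congruence. }
  exists v; split; [|split].
  - intros j; constructor; [|constructor].
    change (sat (tuples_val v (Tin :: Tout :: As) (copy j)) Sigma).
    rewrite (Hcopy j); exact Hsat.
  - specialize (Hcopy Lhs); unfold shared_env; simpl in *; congruence.
  - specialize (Hcopy Lhs); simpl in Hcopy; unfold output; congruence.
Qed.
End Doubling.

Theorem mainTheorem1 (Tin Tout : ty) (As : list ty) (Sigma : fml (Tin :: Tout :: As)) :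
  implicitly_defines Sigma ->
  exists E : expr [Tin] Tout,
    forall (A : Type) (u0 : A) (i : interp A Tin) (o : interp A Tout) (a : env A As),
      sat ((i, (o, a)) : env A (Tin :: Tout :: As)) Sigma ->
      eeval u0 E ((i, tt) : env A [Tin]) = o.
Proof.
  intros Himp.
  destruct (explicit_of_equal Tout _ _ (wf_doubled Sigma) (visible_output Sigma Lhs)
    (visible_output Sigma Rhs)) as [E HE].
  { intros A v; now apply doubled_functional. }
  exists E; intros A u0 i o a Hsat.
  destruct (doubled_satisfiable Sigma u0 i o a Hsat) as (v & Hv & <- & <-).
  exact (HE A u0 v Hv).
Qed.
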